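(* Let $(M,g)$ be a smooth $n$-dimensional Riemannian manifold, $n\ge 3$, with Ricci tensor $\mathsf{Ri}\ne 0$. (i) $\mathsf{Ri}$ cannot be both Ricci recurrent and pseudo Ricci symmetric. (ii) If $\mathsf{Ri}$ is parallel, then the pseudo Ricci symmetric condition cannot be satisfied.
   Context: $g$ is positive definite, $\nabla$ is the covariant derivative (Levi-Civita connection), and a semicolon denotes covariant differentiation. A tensor $T$ is parallel if $\nabla T=0$. The Ricci tensor is Ricci recurrent if there is a nonzero one-form $\beta$ such that $\mathsf{Ri}_{ij;\ell}=\beta_\ell\,\mathsf{Ri}_{ij}$. It is pseudo Ricci symmetric if there is a nonzero one-form $\alpha$ such that $\mathsf{Ri}_{ij;\ell}=2\alpha_\ell\mathsf{Ri}_{ij}+\alpha_i\mathsf{Ri}_{\ell j}+\alpha_j\mathsf{Ri}_{i\ell}$.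
   Formalization: The condition Ri ≠ 0 is taken to mean that Ri does not vanish identically on any connected component of M (for connected M, just Ri ≠ 0); otherwise a sphere together with a disjoint flat piece carrying α is a counterexample. *)

(* Defs.v *)
From mathcomp Require Import all_boot all_order all_algebra.
From mathcomp Require Import ring.
From mathcomp Require Import all_classical all_reals all_analysis.
Set Implicit Arguments.
Unset Strict Implicit.
Unset Printing Implicit Defensive.
Import Order.TTheory GRing.Theory Num.Theory.
Import numFieldNormedType.Exports.
Local Open Scope classical_set_scope.
Local Open Scope ring_scope.

Definition partial (R : realType) (n : nat) (i : 'I_n) (f : 'rV[R]_n -> R)
    : 'rV[R]_n -> R :=
  fun x => 'D_(delta_mx 0 i) f x.

(* C^oo on U: the iterated partial derivatives of every order are Frechet
   differentiable on U (hence continuous). For U open this is equivalent to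
   existence and continuity of all of them on U. *)
Definition smooth_on (R : realType) (n : nat) (U : set 'rV[R]_n)
    (f : 'rV[R]_n -> R) : Prop :=
  forall (s : seq 'I_n) (x : 'rV[R]_n), U x ->
    differentiable (foldr (@partial R n) f s) x.

Record chart (R : realType) (n : nat) (T : topologicalType) := Chart {
  chart_dom : set T;
  chart_map :> T -> 'rV[R]_n;
  chart_inv : 'rV[R]_n -> T;
  chart_img := chart_map @` chart_dom;
  chart_dom_open : open chart_dom;
  chart_img_open : open chart_img;
  chart_mapK : forall p, chart_dom p -> chart_inv (chart_map p) = p;
  chart_map_cont : forall p, chart_dom p -> {for p, continuous chart_map};
  chart_inv_cont : forall x, chart_img x -> {for x, continuous chart_inv} }.

Definition transition (R : realType) (n : nat) (T : topologicalType)
    (c c' : chart R n T) : 'rV[R]_n -> 'rV[R]_n := c' \o chart_inv c.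

Definition overlap (R : realType) (n : nat) (T : topologicalType)
    (c c' : chart R n T) : set 'rV[R]_n :=
  c @` (chart_dom c `&` chart_dom c').

Record manifold (R : realType) (n : nat) := Manifold {
  carrier :> topologicalType;
  manifold_hausdorff : hausdorff_space carrier;
  manifold_second_countable : @second_countable carrier;
  chart_index : Type;
  atlas : chart_index -> chart R n carrier;
  atlas_cover : forall p, exists a, chart_dom (atlas a) p;
  atlas_smooth : forall (a b : chart_index) (k : 'I_n),
    smooth_on (overlap (atlas a) (atlas b))
      (fun x => transition (atlas a) (atlas b) x 0 k) }.

(* A V-valued family of components: one function of the local coordinates for
   each chart of the atlas; only the values on chart_img are meaningful. *)
Definition components (R : realType) (n : nat) (M : manifold R n) (V : Type) :=
  chart_index M -> 'rV[R]_n -> V.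

(* In the row-vector convention, ('J F x) i k = d(F^k)/dx^i. *)
Record one_form (R : realType) (n : nat) (M : manifold R n) := OneForm {
  form_comp :> chart_index M -> 'rV[R]_n -> 'rV[R]_n;
  form_smooth : forall a i,
    smooth_on (chart_img (atlas a)) (fun x => form_comp a x 0 i);
  form_transform : forall a b x, overlap (atlas a) (atlas b) x ->
    let F := transition (atlas a) (atlas b) in
    form_comp a x = form_comp b (F x) *m ('J F x)^T }.

Record metric (R : realType) (n : nat) (M : manifold R n) := Metric {
  metric_comp :> chart_index M -> 'rV[R]_n -> 'M[R]_n;
  metric_smooth : forall a i j,
    smooth_on (chart_img (atlas a)) (fun x => metric_comp a x i j);
  metric_transform : forall a b x, overlap (atlas a) (atlas b) x ->
    let F := transition (atlas a) (atlas b) in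
    metric_comp a x = 'J F x *m metric_comp b (F x) *m ('J F x)^T;
  metric_sym : forall a x, chart_img (atlas a) x ->
    (metric_comp a x)^T = metric_comp a x;
  metric_pos : forall a x, chart_img (atlas a) x ->
    forall v : 'rV[R]_n, v != 0 -> 0 < (v *m metric_comp a x *m v^T) 0 0 }.

Section LocalGeometry.
Variables (R : realType) (n : nat) (G : 'rV[R]_n -> 'M[R]_n).
Implicit Types (i j k l m : 'I_n) (x : 'rV[R]_n).

(* Gamma^k_{ij} *)
Definition christoffel k i j x : R :=
  2^-1 * \sum_l invmx (G x) k l *
    (partial i (fun y => G y j l) x + partial j (fun y => G y i l) x
     - partial l (fun y => G y i j) x).

(* R^l_{kij}, the l-th component of
   (nabla_i nabla_j - nabla_j nabla_i) d_k *)
Definition riemann l k i j x : R :=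
  partial i (christoffel l j k) x - partial j (christoffel l i k) x
  + \sum_m (christoffel l i m x * christoffel m j k x
            - christoffel l j m x * christoffel m i k x).

Definition ricci x : 'M[R]_n := \matrix_(i, j) \sum_l riemann l i l j x.

(* T_{ij;l} *)
Definition cov_deriv (T : 'rV[R]_n -> 'M[R]_n) i j l x : R :=
  partial l (fun y => T y i j) x
  - \sum_m (christoffel m l i x * T x m j + christoffel m l j x * T x i m).

End LocalGeometry.

(* On each chart of a Riemannian manifold the three lemmas below characterize
   christoffel as the symbols of the unique torsion-free metric connection (Levi-Civita). *)
Section LeviCivita.
Variables (R : realType) (n : nat) (M : manifold R n) (g : metric M).
Variables (a : chart_index M) (x : 'rV[R]_n).
Hypothesis ax : chart_img (atlas a) x.

Let partial_metric_sym i j l :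
  partial l (fun y => g a y i j) x = partial l (fun y => g a y j i) x.
Proof.
apply: near_eq_derive.
have : nbhs x (chart_img (atlas a)).
  by apply: open_nbhs_nbhs; split=> //; exact: chart_img_open.
by apply: filterS => y ay; rewrite -[in LHS](metric_sym g ay) mxE.
Qed.

Let metricE i j : g a x i j = g a x j i.
Proof. by rewrite -[in LHS](metric_sym g ax) mxE. Qed.

Let metric_unit : g a x \in unitmx.
Proof.
rewrite -row_free_unit -kermx_eq0; apply/eqP/row_matrixP => i.
rewrite row0; apply/eqP/negPn/negP => /(metric_pos g ax).
have /sub_kermxP -> : (row i (kermx (g a x)) <= kermx (g a x))%MS.
  exact: row_sub.
by rewrite mul0mx mxE ltxx.
Qed.

Lemma christoffel_torsion_free i j k :
  christoffel (g a) k i j x = christoffel (g a) k j i x.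
Proof.
rewrite /christoffel; congr (_ * _); apply: eq_bigr => l _; congr (_ * _).
by rewrite (partial_metric_sym i j l); ring.
Qed.

Let lowered i j k : \sum_m christoffel (g a) m i j x * g a x m k =
  2^-1 * (partial i (fun y => g a y j k) x + partial j (fun y => g a y i k) x
          - partial k (fun y => g a y i j) x).
Proof.
pose K l := partial i (fun y => g a y j l) x + partial j (fun y => g a y i l) x
  - partial l (fun y => g a y i j) x.
rewrite [RHS](_ : _ = 2^-1 * K k)//.
transitivity (2^-1 * \sum_l K l * (g a x *m invmx (g a x)) k l).
  rewrite !mulr_sumr.
  under eq_bigr do rewrite /christoffel -/(K _) -mulrA mulr_suml mulr_sumr.
  rewrite exchange_big; apply: eq_bigr => l _ /=.
  rewrite mxE !mulr_sumr; apply: eq_bigr => m _.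
  by rewrite (metricE k m) /K; ring.
rewrite mulmxV // (bigD1 k) //= big1 ?addr0 => [|l lk]; rewrite mxE.
  by rewrite eqxx mulr1.
by rewrite eq_sym (negPf lk) mulr0.
Qed.

Lemma christoffel_metric i j l : cov_deriv (g a) (g a) i j l x = 0.
Proof.
rewrite /cov_deriv big_split /= lowered.
rewrite [X in _ - (_ + X)](eq_bigr _ (fun m _ => congr1 _ (metricE i m))).
by rewrite lowered (partial_metric_sym j i l); field.
Qed.

Lemma levi_civita_unique (Gam : 'I_n -> 'I_n -> 'I_n -> R) :
    (forall k i j, Gam k i j = Gam k j i) ->
    (forall i j l, partial l (fun y => g a y i j) x =
       \sum_m (Gam m l i * g a x m j + Gam m l j * g a x i m)) ->
  forall k i j, Gam k i j = christoffel (g a) k i j x.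
Proof.
move=> Gs Gm k i j.
pose L i j k := \sum_m Gam m i j * g a x m k.
have Ls p q r : L p q r = L q p r by apply: eq_bigr => m _; rewrite Gs.
have LE p q r : partial r (fun y => g a y p q) x = L r p q + L r q p.
  rewrite Gm big_split; congr (_ + _); apply: eq_bigr => m _.
  by rewrite (metricE p m).
have {}LE p : L i j p = \sum_m christoffel (g a) m i j x * g a x m p.
  by rewrite lowered !LE (Ls p i j) (Ls p j i) (Ls j i p); field.
pose u := (\row_m Gam m i j) : 'rV[R]_n.
pose v := (\row_m christoffel (g a) m i j x) : 'rV[R]_n.
suff : u = v by move/rowP => /(_ k); rewrite !mxE.
apply: (can_inj (mulmxK metric_unit)); apply/rowP => p; rewrite !mxE.
have := LE p; rewrite /L => e.
under eq_bigr do rewrite mxE; rewrite e.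
by apply: eq_bigr => m _; rewrite mxE.
Qed.

End LeviCivita.

Section TensorConditions.
Variables (R : realType) (n : nat) (M : manifold R n) (g : metric M).

Definition nonzero_at (V : nmodType) (T : components M V) (p : M) : Prop :=
  exists2 a, chart_dom (atlas a) p & T a (atlas a p) != 0.

(* "T <> 0": T does not vanish identically on any connected component of M. If
   M is connected this is just "T is not the zero tensor field", see
   connected_nonzero_tensor below; it also covers nowhere vanishing T. *)
Definition nonzero_tensor (V : nmodType) (T : components M V) : Prop :=
  forall p : M, exists2 q, connected_component [set: M] p q & nonzero_at T q.

Definition nonzero_form (w : one_form M) : Prop := exists p, nonzero_at (form_comp w) p.

Definition ricci_tensor : components M 'M[R]_n := fun a => ricci (g a).

(* T_{ij;l} in the chart of index a *)
Definition nabla (T : components M 'M[R]_n) (a : chart_index M)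
    (x : 'rV[R]_n) (i j l : 'I_n) : R :=
  cov_deriv (g a) (T a) i j l x.

Definition parallel (T : components M 'M[R]_n) : Prop :=
  forall a x, chart_img (atlas a) x -> forall i j l, nabla T a x i j l = 0.

Definition recurrent (T : components M 'M[R]_n) : Prop :=
  exists2 beta : one_form M, nonzero_form beta &
    forall a x, chart_img (atlas a) x -> forall i j l,
      nabla T a x i j l = beta a x 0 l * T a x i j.

Definition pseudo_symmetric (T : components M 'M[R]_n) : Prop :=
  exists2 alpha : one_form M, nonzero_form alpha &
    forall a x, chart_img (atlas a) x -> forall i j l,
      nabla T a x i j l = 2 * alpha a x 0 l * T a x i j
        + alpha a x 0 i * T a x l j + alpha a x 0 j * T a x i l.

Lemma connected_nonzero_tensor (V : nmodType) (T : components M V) :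
  connected [set: M] ->
  [set: M] !=set0 -> nonzero_tensor T <-> exists p, nonzero_at T p.
Proof.
move=> Mc [p0 _]; split => [/(_ p0)[q _ ?]|[q Tq] p]; first by exists q.
by exists q => //; rewrite connected_component_id.
Qed.

End TensorConditions.

(* Main.v *)
(* A parallel Ricci tensor is treated as recurrent with beta = 0. If
   nabla Ric = beta (x) Ric, then along any curve Ric solves a linear ODE, so it
   vanishes nowhere on a connected component where it does not vanish
   identically; this makes Ric nonzero at a point where alpha is nonzero. There
   the two conditions force Ric = c alpha (x) alpha with c <> 0. The Ricci
   identity gives R(X,Y).Ric = - dbeta(X,Y) Ric (up to sign conventions), whose
   g-trace is 0 on the left because R(X,Y) is g-skew and a nonzero multiple of
   dbeta(X,Y) on the right. Hence dbeta = 0 and R(X,Y) alpha = 0, so that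
   Ric(alpha^#, .) = 0, which contradicts c |alpha|^2 <> 0. *)
Require Import Defs.
From mathcomp Require Import all_boot all_order all_algebra.
From mathcomp Require Import ring lra.
From mathcomp Require Import all_classical all_reals all_analysis.
Set Implicit Arguments.
Unset Strict Implicit.
Unset Printing Implicit Defensive.
Import Order.TTheory GRing.Theory Num.Theory.
Import numFieldNormedType.Exports.
Local Open Scope classical_set_scope.
Local Open Scope ring_scope.

(** The components of Ric are coordinate formulas, chart by chart, and [nonzero_at] only asks for
    one chart with a nonzero value. Spreading zeros of Ric, and bringing the chart where Ric is
    nonzero together with the one where alpha is, therefore requires change-of-chart laws. The law
    for Ric does not come from transforming Christoffel symbols by hand: the transported connection
    is shown to be torsion-free and metric, and uniqueness of the Levi-Civita connection identifies
    it. Curves crossing several charts are avoided as well: an estimate along rays inside one chart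
    shows that the zero set of Ric is open, and connectedness does the rest. Christoffel symbols are
    gathered into matrices A_i, which turns most curvature computations into noncommutative
    polynomial identities. A single commutation identity for d_i T = A_i T + T A_i^T + b_i T then
    serves twice: T = g with b = 0 gives the skewness of the curvature, and T = Ric ties its action
    to dbeta. *)

Lemma near_eq_differentiable (R : numFieldType) (V W : normedModType R)
    (f g : V -> W) (x : V) :
  {near x, f =1 g} -> differentiable f x -> differentiable g x.
Proof.
move=> fg df.
have fgx : f x = g x by exact: nbhs_singleton fg.
have gdf : g \o shift x = cst (g x) + 'd f x +o_ 0 id.
  apply/eqaddoP => e e0.
  have /eqaddoP/(_ e e0) := diff_locally df.
  apply: filterS2; last first.
    have : \forall y \near (0 : V), f (y + x) = g (y + x).
      by move: fg; rewrite (near_shift 0) /= subr0.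
    exact.
  by move=> y /= fgy; rewrite -[(_ - _) y]/(_ - _) /= -fgx fgy; exact.
have gf : 'd g x = 'd f x :> (V -> W) by exact/diff_unique/gdf/diff_continuous.
by apply/diff_locallyP; rewrite gf; split => //; exact: diff_continuous.
Qed.

(** * Partial derivatives and smooth functions *)

Section PartialCalculus.
Variables (R : realType) (n : nat).
Implicit Types (f h : 'rV[R]_n -> R) (x : 'rV[R]_n) (i j : 'I_n) (U : set 'rV[R]_n).

Lemma open_near U (P : set 'rV[R]_n) x : open U -> U x ->
  (forall y, U y -> P y) -> \forall y \near x, P y.
Proof. by move=> oU Ux UP; apply: filterS UP _; exact: open_nbhs_nbhs. Qed.

Lemma eq_partial U f h i x : open U -> U x ->
  (forall y, U y -> f y = h y) -> partial i f x = partial i h x.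
Proof. by move=> oU Ux fh; apply: near_eq_derive; exact: open_near fh. Qed.

Lemma partialD i f h x : differentiable f x -> differentiable h x ->
  partial i (fun y => f y + h y) x = partial i f x + partial i h x.
Proof. by move=> df dh; apply: deriveD; exact: diff_derivable. Qed.

Lemma partialM i f h x : differentiable f x -> differentiable h x ->
  partial i (fun y => f y * h y) x = partial i f x * h x + f x * partial i h x.
Proof.
move=> df dh; rewrite /partial (@deriveM _ _ f h); try exact: diff_derivable.
by rewrite !/(_ *: _) /= addrC [h x * _]mulrC.
Qed.

(** The right side is spelled with constants, products and inverses only, to match the constructors
    of [smooth_gen]. *)
Lemma partialV i f x : differentiable f x -> f x != 0 ->
  partial i (fun y => (f y)^-1) x = - 1 * (partial i f x * ((f x)^-1 * (f x)^-1)).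
Proof.
move=> df fx; rewrite /partial (@deriveV _ _ f) //; last exact: diff_derivable.
by rewrite /(_ *: _) /= mulN1r mulNr expr2 invfM [in LHS]mulrC.
Qed.

Lemma partial_cst i (c : R) x : partial i (fun=> c) x = 0.
Proof. exact: derive_cst. Qed.

Lemma differentiable_bigsum (I : Type) (r : seq I) (F : I -> 'rV[R]_n -> R) x :
  (forall k, differentiable (F k) x) ->
  differentiable (fun y => \sum_(k <- r) F k y) x.
Proof.
move=> dF; elim: r => [|k r IHr].
  rewrite (_ : (fun _ => _) = cst 0); first exact: differentiable_cst.
  by apply/funext => y; rewrite big_nil.
rewrite (_ : (fun _ => _) = F k + (fun y => \sum_(k <- r) F k y)).
  exact: differentiableD.
by apply/funext => y; rewrite big_cons.
Qed.

Lemma partial_sum i (I : Type) (r : seq I) (F : I -> 'rV[R]_n -> R) x :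
  (forall k, differentiable (F k) x) ->
  partial i (fun y => \sum_(k <- r) F k y) x = \sum_(k <- r) partial i (F k) x.
Proof.
move=> dF; elim: r => [|k r IHr].
  by rewrite big_nil (_ : (fun _ => _) = fun=> 0) ?partial_cst //;
    apply/funext => y; rewrite big_nil.
rewrite big_cons -IHr -partialD //; last exact: differentiable_bigsum.
by congr partial; apply/funext => y; rewrite big_cons.
Qed.

Lemma derive_partial f x v : differentiable f x ->
  'D_v f x = \sum_i v 0 i * partial i f x.
Proof.
move=> df; rewrite deriveE // [in LHS](row_sum_delta v) linear_sum.
by apply: eq_bigr => i _; rewrite linearZ /= /partial deriveE.
Qed.

End PartialCalculus.

(** * Closure properties of smooth functions *)

Section Smooth.
Variables (R : realType) (n : nat).
Implicit Types (f h : 'rV[R]_n -> R) (x : 'rV[R]_n) (i j : 'I_n) (U : set 'rV[R]_n).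

Lemma eq_foldr_partial U f h s x : open U ->
  (forall y, U y -> f y = h y) -> U x ->
  foldr (@partial R n) f s x = foldr (@partial R n) h s x.
Proof.
move=> oU fh; elim: s x => [|i s IHs] x Ux /=; first exact: fh.
exact: (eq_partial _ oU Ux).
Qed.

Lemma smooth_differentiable U f x : smooth_on U f -> U x -> differentiable f x.
Proof. by move=> /(_ [::]) /[apply]. Qed.

Lemma smooth_partial U f i : smooth_on U f -> smooth_on U (partial i f).
Proof. by move=> sf s x Ux; move: (sf (rcons s i) x Ux); rewrite foldr_rcons. Qed.

(** The list is peeled at its end because [foldr] applies that index first: the innermost derivative
    is replaced by a member [h] of [P] that equals it on [U], and the induction resumes from [h]. *)
Lemma smooth_coind U (P : ('rV[R]_n -> R) -> Prop) : open U ->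
  (forall f, P f -> forall x, U x -> differentiable f x) ->
  (forall f, P f -> forall i,
     exists2 h, P h & forall x, U x -> partial i f x = h x) ->
  forall f, P f -> smooth_on U f.
Proof.
move=> oU Pd PD f Pf s; elim/last_ind: s f Pf => [|s i IHs] f Pf x Ux /=.
  exact: Pd Pf _ Ux.
rewrite foldr_rcons; have [h Ph fh] := PD f Pf i.
apply: near_eq_differentiable (IHs h Ph x Ux).
by apply: (open_near oU Ux) => y Uy; apply: (eq_foldr_partial _ oU) => // z /fh.
Qed.

Lemma eq_smooth U f h : open U -> (forall x, U x -> f x = h x) ->
  smooth_on U f -> smooth_on U h.
Proof.
move=> oU fh sf s x Ux; apply: near_eq_differentiable (sf s x Ux).
by apply: (open_near oU Ux) => y Uy; exact: (eq_foldr_partial _ oU).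
Qed.

(** Leibniz and quotient rules mix sums, products and inverses, so smoothness is proved for all
    these operations at once, on the class they generate. *)
Inductive smooth_gen U : ('rV[R]_n -> R) -> Prop :=
| SGbase f : smooth_on U f -> smooth_gen U f
| SGcst c : smooth_gen U (fun=> c)
| SGadd f h : smooth_gen U f -> smooth_gen U h -> smooth_gen U (fun x => f x + h x)
| SGmul f h : smooth_gen U f -> smooth_gen U h -> smooth_gen U (fun x => f x * h x)
| SGinv f : smooth_gen U f -> (forall x, U x -> f x != 0) ->
    smooth_gen U (fun x => (f x)^-1).

Lemma smooth_gen_differentiable U f x : smooth_gen U f -> U x -> differentiable f x.
Proof.
elim=> {f} [f sf|c|f h _ df _ dh|f h _ df _ dh|f _ df f0] Ux.
- exact: smooth_differentiable sf Ux.
- exact: differentiable_cst.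
- by apply: differentiableD; [exact: df|exact: dh].
- by apply: differentiableM; [exact: df|exact: dh].
- by apply: differentiableV; [exact: df|exact: f0].
Qed.

(* The class generated by the smooth functions is closed under partial
   derivatives, so its members are smooth. *)
Lemma smooth_genP U f : open U -> smooth_gen U f -> smooth_on U f.
Proof.
move=> oU; apply: (smooth_coind oU) => {f} [f sf x|f]; first exact: smooth_gen_differentiable.
elim=> {f} [f sf|c|f h gf IHf gh IHh|f h gf IHf gh IHh|f gf IHf f0] i.
- by exists (partial i f) => //; apply: SGbase; exact: smooth_partial.
- by exists (fun=> 0) => [|x _]; [exact: SGcst|rewrite partial_cst].
- have [f' gf' ff'] := IHf i; have [h' gh' hh'] := IHh i.
  exists (fun x => f' x + h' x) => [|x Ux]; first exact: SGadd.
  by rewrite partialD ?ff' ?hh' //; apply: smooth_gen_differentiable Ux.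
- have [f' gf' ff'] := IHf i; have [h' gh' hh'] := IHh i.
  exists (fun x => f' x * h x + f x * h' x) => [|x Ux].
    by apply: SGadd; exact: SGmul.
  by rewrite partialM ?ff' ?hh' //; apply: smooth_gen_differentiable Ux.
- have [f' gf' ff'] := IHf i.
  exists (fun x => - 1 * (f' x * ((f x)^-1 * (f x)^-1))) => [|x Ux].
    by apply: (@SGmul _ (fun=> - 1)); [exact: SGcst|];
      apply: SGmul => //; apply: SGmul; exact: SGinv.
  by rewrite partialV ?ff' ?f0 //; apply: smooth_gen_differentiable Ux.
Qed.

Variable U : set 'rV[R]_n.
Hypothesis oU : open U.

Lemma smooth_cst c : smooth_on U (fun=> c).
Proof. by apply: smooth_genP => //; exact: SGcst. Qed.

Lemma smoothD f h : smooth_on U f -> smooth_on U h -> smooth_on U (fun x => f x + h x).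
Proof. by move=> sf sh; apply: smooth_genP => //; apply: SGadd; exact: SGbase. Qed.

Lemma smoothM f h : smooth_on U f -> smooth_on U h -> smooth_on U (fun x => f x * h x).
Proof. by move=> sf sh; apply: smooth_genP => //; apply: SGmul; exact: SGbase. Qed.

Lemma smoothV f : smooth_on U f -> (forall x, U x -> f x != 0) ->
  smooth_on U (fun x => (f x)^-1).
Proof. by move=> sf f0; apply: smooth_genP => //; apply: SGinv f0; exact: SGbase. Qed.

Lemma smoothB f h : smooth_on U f -> smooth_on U h -> smooth_on U (fun x => f x - h x).
Proof.
move=> sf sh; apply: (@eq_smooth _ (fun x => f x + - 1 * h x)) => // [x _|].
  by rewrite mulN1r.
by apply: smoothD => //; apply: smoothM => //; exact: smooth_cst.
Qed.

Lemma smooth_sum (I : Type) (r : seq I) (P : pred I) (F : I -> 'rV[R]_n -> R) :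
  (forall k, smooth_on U (F k)) -> smooth_on U (fun x => \sum_(k <- r | P k) F k x).
Proof.
move=> sF; elim: r => [|k r IHr].
  apply: eq_smooth (smooth_cst 0) => // x _; by rewrite big_nil.
have [Pk|nPk] := boolP (P k).
  by apply: eq_smooth (smoothD (sF k) IHr) => // x _; rewrite big_cons Pk.
by apply: eq_smooth IHr => // x _; rewrite big_cons (negPf nPk).
Qed.

Lemma smooth_prod (I : Type) (r : seq I) (P : pred I) (F : I -> 'rV[R]_n -> R) :
  (forall k, smooth_on U (F k)) -> smooth_on U (fun x => \prod_(k <- r | P k) F k x).
Proof.
move=> sF; elim: r => [|k r IHr].
  apply: eq_smooth (smooth_cst 1) => // x _; by rewrite big_nil.
have [Pk|nPk] := boolP (P k).
  by apply: eq_smooth (smoothM (sF k) IHr) => // x _; rewrite big_cons Pk.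
by apply: eq_smooth IHr => // x _; rewrite big_cons (negPf nPk).
Qed.

Definition smooth_mx p q (A : 'rV[R]_n -> 'M[R]_(p, q)) :=
  forall k l, smooth_on U (fun x => A x k l).

Lemma smooth_det p (A : 'rV[R]_n -> 'M[R]_p) :
  smooth_mx A -> smooth_on U (fun x => \det (A x)).
Proof.
move=> sA; rewrite /determinant; apply: smooth_sum => s.
by apply: smoothM; [exact: smooth_cst|exact: smooth_prod].
Qed.

(** Cramer's rule: each entry is a cofactor over the determinant. *)
Lemma smooth_invmx p (A : 'rV[R]_n -> 'M[R]_p) :
  (forall x, U x -> A x \in unitmx) -> smooth_mx A ->
  smooth_mx (fun x => invmx (A x)).
Proof.
move=> uA sA k l.
apply: (@eq_smooth _ (fun x => (\det (A x))^-1 * cofactor (A x) l k)) => // [x Ux|].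
  by rewrite /invmx uA // !mxE.
apply: smoothM.
  by apply: smoothV => [|x /uA]; [exact: smooth_det|rewrite unitmxE unitfE].
rewrite /cofactor; apply: smoothM; first exact: smooth_cst.
apply: smooth_det => a b; apply: eq_smooth (sA (lift l a) (lift k b)) => // x _.
by rewrite !mxE.
Qed.

Lemma smooth_mulmx p q r (A : 'rV[R]_n -> 'M[R]_(p, q)) (B : 'rV[R]_n -> 'M[R]_(q, r)) :
  smooth_mx A -> smooth_mx B -> smooth_mx (fun x => A x *m B x).
Proof.
move=> sA sB k l.
apply: (@eq_smooth _ (fun x => \sum_m A x k m * B x m l)) => // [x _|].
  by rewrite mxE.
by apply: smooth_sum => m; exact: smoothM.
Qed.

Lemma smoothmxD p q (A B : 'rV[R]_n -> 'M[R]_(p, q)) :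
  smooth_mx A -> smooth_mx B -> smooth_mx (fun x => A x + B x).
Proof.
move=> sA sB k l; apply: eq_smooth (smoothD (sA k l) (sB k l)) => // x _.
by rewrite mxE.
Qed.

Lemma smoothmxB p q (A B : 'rV[R]_n -> 'M[R]_(p, q)) :
  smooth_mx A -> smooth_mx B -> smooth_mx (fun x => A x - B x).
Proof.
move=> sA sB k l; apply: eq_smooth (smoothB (sA k l) (sB k l)) => // x _.
by rewrite !mxE.
Qed.

Definition dmx p q i (A : 'rV[R]_n -> 'M[R]_(p, q)) x : 'M[R]_(p, q) :=
  \matrix_(k, l) partial i (fun y => A y k l) x.

Lemma smooth_dmx p q i (A : 'rV[R]_n -> 'M[R]_(p, q)) :
  smooth_mx A -> smooth_mx (dmx i A).
Proof.
move=> sA k l; apply: eq_smooth (smooth_partial i (sA k l)) => // x _.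
by rewrite mxE.
Qed.

End Smooth.

(** * Mean value theorem and symmetry of second derivatives *)

Section MeanValue.
Variables (R : realType) (n : nat).
Implicit Types (f h : 'rV[R]_n -> R) (x v : 'rV[R]_n) (i j : 'I_n) (U : set 'rV[R]_n).

Lemma is_derive_line f x v (t : R) : differentiable f (x + t *: v) ->
  is_derive t 1 (fun s : R => f (x + s *: v)) ('D_v f (x + t *: v)).
Proof.
move=> /(@diff_derivable _ _ _ _ _ v) df.
have E : (fun s : R => s^-1 *: (f (x + (s *: 1 + t) *: v) - f (x + t *: v))) =
    (fun s => s^-1 *: (f (s *: v + (x + t *: v)) - f (x + t *: v))).
  apply/funext => s; congr (_ *: (f _ - _)).
  by rewrite scalerDl addrCA /(_ *: 1) /= mulr1.
by split; rewrite /derivable /derive E.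
Qed.

Lemma derive_translate f x v w : 'D_v (fun y => f (y + w)) x = 'D_v f (x + w).
Proof.
rewrite /derive; set F := (fun _ => _); set G := (fun _ => _).
suff -> : F = G by [].
by apply/funext => s; rewrite /F /G /= addrA.
Qed.

Lemma line_mean_value f x v (t : R) : 0 <= t ->
  (forall s, 0 <= s <= t -> differentiable f (x + s *: v)) ->
  exists2 c, 0 <= c <= t & f (x + t *: v) - f x = t * 'D_v f (x + c *: v).
Proof.
move=> t0 df.
have [||c] := @MVT_segment R (fun s => f (x + s *: v))
  (fun s => 'D_v f (x + s *: v)) 0 t t0.
- move=> s; rewrite in_itv => /andP[s0 st].
  by apply/is_derive_line/df; rewrite !ltW.
- apply: derivable_within_continuous => s; rewrite in_itv => st.
  by have [] := is_derive_line (df s st).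
rewrite in_itv scale0r addr0 subr0 => ct e; exists c => //.
by rewrite e mulrC.
Qed.

(** The mean value theorem is used twice: in direction [i] for the increment [h] of [f] over
    [t *: v], then in direction [j] for [partial i f]. *)
Lemma second_difference U f i j x (t : R) : smooth_on U f -> 0 <= t ->
  (forall r s, 0 <= r <= t -> 0 <= s <= t ->
     U (x + r *: delta_mx 0 i + s *: delta_mx 0 j)) ->
  exists r s, [/\ 0 <= r <= t, 0 <= s <= t &
    f (x + t *: delta_mx 0 i + t *: delta_mx 0 j) - f (x + t *: delta_mx 0 i)
      - (f (x + t *: delta_mx 0 j) - f x) =
    t * (t * partial j (partial i f) (x + r *: delta_mx 0 i + s *: delta_mx 0 j))].
Proof.
move=> sf t0 Ut; set u := delta_mx 0 i in Ut *; set v := delta_mx 0 j in Ut *.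
have tt : 0 <= t <= t by rewrite t0 lexx.
have zt : 0 <= (0 : R) <= t by rewrite t0 lexx.
have dt r s : 0 <= r <= t -> 0 <= s <= t -> differentiable f (x + r *: u + s *: v).
  by move=> rt st; exact: smooth_differentiable sf (Ut _ _ rt st).
pose h := fun y => f (y + t *: v) - f y.
have dsh y : differentiable f (y + t *: v) -> differentiable (fun y => f (y + t *: v)) y.
  by move=> df; apply: (@differentiable_comp _ _ _ _ (fun y => y + t *: v) f).
have [s st|r rt] := @line_mean_value h x u t t0.
  have ds : differentiable f (x + s *: u).
    by have := dt s 0 st zt; rewrite scale0r addr0.
  exact: (@differentiableB _ _ _ (fun y => f (y + t *: v)) f _ (dsh _ (dt _ _ st tt)) ds).
have dr : differentiable f (x + r *: u).
  by have := dt r 0 rt zt; rewrite scale0r addr0.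
have -> : 'D_u h (x + r *: u) = partial i f (x + r *: u + t *: v) - partial i f (x + r *: u).
  rewrite /h (@deriveB _ _ _ (fun y => f (y + t *: v)) f); last 2 first.
  - by apply: diff_derivable; apply: dsh; apply: dt.
  - by apply: diff_derivable.
  by rewrite derive_translate.
move=> e.
have [s st|s st e'] := @line_mean_value (partial i f) (x + r *: u) v t t0.
  exact: smooth_differentiable (smooth_partial i sf) (Ut _ _ rt st).
by exists r, s; split => //; rewrite -/(h _) -/(h x) e e'.
Qed.

Lemma norm_delta_mx i : `|delta_mx 0 i : 'rV[R]_n| <= 1.
Proof.
rewrite /Num.Def.normr /= mx_normrE; apply: bigmax_le => //= k _.
by rewrite mxE; case: (_ && _); rewrite ?normr1 ?normr0.
Qed.

Lemma lt_halves_false (u v w : R) : w <= u + v -> u < w / 2 -> v < w / 2 -> False.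
Proof. by move=> *; lra. Qed.

(* Both mixed partials are, up to the factor t^2, values of the same second
   difference at points close to x. *)
Lemma partial_comm U f i j x : open U -> smooth_on U f -> U x ->
  partial i (partial j f) x = partial j (partial i f) x.
Proof.
move=> oU sf Ux; apply/eqP/negPn/negP => ne.
set a := partial i _ x in ne *; set b := partial j _ x in ne *.
(* By the triangle inequality, a value within [e] of [a] cannot coincide with one within [e] of
   [b]. *)
pose e := `|a - b| / 2; have e0 : 0 < e by rewrite divr_gt0 // normr_gt0 subr_eq0.
have cont k l : {for x, continuous (partial k (partial l f))}.
  apply: differentiable_continuous.
  exact: smooth_differentiable (smooth_partial _ (smooth_partial _ sf)) Ux.
have : \forall y \near x, [/\ U y, `|a - partial i (partial j f) y| < e &
    `|b - partial j (partial i f) y| < e].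
  have nU : nbhs x U by exact: open_nbhs_nbhs.
  have /cvgrPdist_lt/(_ _ e0) na := cont i j.
  have /cvgrPdist_lt/(_ _ e0) nb := cont j i.
  apply: filterS (filterI nU (filterI na nb)) => y [Uy [Ay By]].
  by split; [exact: Uy|exact: Ay|exact: By].
move=> /nbhs_ballP[d /= d0 Bd].
(* Coordinate vectors have norm at most 1, so the whole parallelogram of side [t] stays within 2d/3
   of [x]. *)
pose t := d / 3; have t0 : 0 < t by rewrite divr_gt0.
have Bt k l r s : 0 <= r <= t -> 0 <= s <= t ->
    ball x d (x + r *: delta_mx 0 k + s *: delta_mx 0 l).
  move=> /andP[r0 rt] /andP[s0 st]; rewrite -ball_normE /= -addrA opprD addNKr normrN.
  apply: le_lt_trans (ler_normD _ _) _; rewrite !normrZ (ger0_norm r0) (ger0_norm s0).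
  apply: (@le_lt_trans _ _ (r * 1 + s * 1)).
    by apply: lerD; apply: ler_wpM2l => //; exact: norm_delta_mx.
  by rewrite !mulr1; apply: le_lt_trans (lerD rt st) _; rewrite /t; lra.
have [r [s [rt st Ee]]] := second_difference sf (ltW t0) (fun r s rt st =>
  let: And3 P _ _ := Bd _ (Bt i j r s rt st) in P).
have [r' [s' [rt' st' Ee']]] := second_difference sf (ltW t0) (fun r s rt st =>
  let: And3 P _ _ := Bd _ (Bt j i r s rt st) in P).
have swap_sub (u v w z : R) : u - v - (w - z) = u - w - (v - z) by ring.
have Dee : partial j (partial i f) (x + r *: delta_mx 0 i + s *: delta_mx 0 j) =
    partial i (partial j f) (x + r' *: delta_mx 0 j + s' *: delta_mx 0 i).
  apply: (mulfI (lt0r_neq0 t0)); apply: (mulfI (lt0r_neq0 t0)).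
  apply: etrans (esym Ee) (etrans _ Ee').
  rewrite (addrAC x (t *: delta_mx 0 j)).
  exact: swap_sub.
have [_ _ A] := Bd _ (Bt i j r s rt st).
have [_ B _] := Bd _ (Bt j i r' s' rt' st').
move: A B; rewrite Dee; set c := partial i _ _ => A B.
rewrite (distrC b c) in A.
exact: lt_halves_false (ler_distD c a b) B A.
Qed.

End MeanValue.

(** Squares replace absolute values to keep [S] differentiable. Since S' <= C S, the product of [S]
    with exp(- C t) is nonincreasing; it starts at 0 and is nonnegative. *)
Lemma gronwall_zero (R : realType) (I : finType) (h h' : I -> R -> R) (K : R) : 0 <= K ->
  (forall k (t : R), 0 <= t <= 1 -> is_derive t 1 (h k) (h' k t)) ->
  (forall k (t : R), 0 <= t <= 1 -> `|h' k t| <= K * \sum_m `|h m t|) ->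
  (forall k, h k 0 = 0) -> forall k, h k 1 = 0.
Proof.
move=> K0 dh bh h0.
pose S (t : R) := \sum_k h k t ^+ 2.
pose C := 2 * (K * #|I|%:R).
pose phi (t : R) := S t * expR (- C * t).
pose dphi (t : R) := (\sum_k 2 * (h k t * h' k t) - C * S t) * expR (- C * t).
have dphi01 (t : R) : 0 <= t <= 1 -> is_derive t 1 phi (dphi t).
  move=> t01.
  have dS : is_derive t 1 S (\sum_k 2 * (h k t * h' k t)).
    rewrite /S; elim: (index_enum I) => [|k r IHr].
      rewrite big_nil (_ : (fun _ => _) = cst 0); first exact: is_derive_cst.
      by apply/funext => s; rewrite big_nil.
    rewrite big_cons (_ : (fun _ => _) = (h k * h k) + (fun s => \sum_(k <- r) h k s ^+ 2)).
      have dk := dh k t t01.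
      by apply: is_derive_eq; rewrite mulr_natl mulr2n.
    by apply/funext => s; rewrite big_cons.
  have dE : is_derive t 1 (fun s => expR (- C * s)) (- C * expR (- C * t)).
    have dl : is_derive t 1 (fun s : R => - C * s) (- C).
      by apply: is_derive_eq; rewrite /(_ *: _) /= mulr1.
    rewrite mulrC; exact: (@is_derive1_comp _ expR).
  rewrite (_ : phi = S * (fun s => expR (- C * s))) //.
  apply: is_derive_eq; rewrite /dphi.
  set D := \sum_k 2 * _; set E := expR _.
  rewrite [LHS](_ : _ = S t * (- C * E) + E * D) //; ring.
have dphi_le0 (t : R) : 0 <= t <= 1 -> dphi t <= 0.
  move=> t01; rewrite /dphi pmulr_lle0 ?expR_gt0 // subr_le0.
  rewrite /C -mulr_sumr -mulrA ler_pM2l //.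
  (* This rests on 2|h_k h_m| <= h_k^2 + h_m^2; summing over all pairs k, m produces the factor
     [#|I|] in [C]. *)
  have hm k : h k t * h' k t <= K * \sum_m (h k t ^+ 2 + h m t ^+ 2) / 2.
    apply: le_trans (ler_norm _) _; rewrite normrM.
    apply: (le_trans (ler_wpM2l (normr_ge0 _) (bh k t t01))).
    rewrite mulrCA; apply: ler_wpM2l => //; rewrite mulr_sumr; apply: ler_sum => m _.
    rewrite -[h k t ^+ 2]real_normK ?num_real // -[h m t ^+ 2]real_normK ?num_real //.
    have := sqr_ge0 (`|h k t| - `|h m t|); set a := `|h k t|; set b := `|h m t|.
    by rewrite sqrrB => ?; lra.
  apply: (le_trans (ler_sum _ (fun k _ => hm k))).
  rewrite -mulr_sumr -mulrA; under eq_bigr do rewrite -mulr_suml big_split /= sumr_const.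
  rewrite -mulr_suml big_split /= sumr_const -/(S t).
  under eq_bigr do rewrite -mulr_natr.
  by rewrite -mulr_suml -/(S t) -mulr_natr; rewrite le_eqVlt; apply/orP; left; apply/eqP; field.
have S0 t : 0 <= S t by apply: sumr_ge0 => k _; exact: sqr_ge0.
have : phi 1 <= phi 0.
  have [||c] := @MVT_segment R phi dphi 0 1 ler01.
  - by move=> t; rewrite in_itv => /andP[? ?]; apply: dphi01; rewrite !ltW.
  - apply: derivable_within_continuous => t; rewrite in_itv => t01.
    by have [] := dphi01 t t01.
  rewrite in_itv subr0 mulr1 => c01 e.
  by rewrite -subr_le0 e; exact: dphi_le0.
rewrite /phi [S 0]big1 ?mul0r => [|k _]; last by rewrite h0 expr0n.
rewrite pmulr_lle0 ?expR_gt0 // => S1 k.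
have /eqP : S 1 = 0 by apply/eqP; rewrite eq_le S1 S0.
rewrite psumr_eq0 => [/allP/(_ k)|m _]; last exact: sqr_ge0.
by rewrite mem_index_enum => /(_ isT); rewrite sqrf_eq0 => /eqP.
Qed.

Lemma mx_addE (V : nmodType) p q (A B : 'M[V]_(p, q)) k l : (A + B) k l = A k l + B k l.
Proof. by rewrite mxE. Qed.

Lemma mx_oppE (V : zmodType) p q (A : 'M[V]_(p, q)) k l : (- A) k l = - A k l.
Proof. by rewrite mxE. Qed.

Lemma mx_scaleE (R : pzRingType) p q c (A : 'M[R]_(p, q)) k l : (c *: A) k l = c * A k l.
Proof. by rewrite mxE. Qed.

Lemma mx_mulE (R : pzRingType) p q r (A : 'M[R]_(p, q)) (B : 'M[R]_(q, r)) k l :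
  (A *m B) k l = \sum_m A k m * B m l.
Proof. by rewrite mxE. Qed.

Lemma mx_trE (R : pzRingType) p q (A : 'M[R]_(p, q)) k l : A^T k l = A l k.
Proof. by rewrite mxE. Qed.

(** * Matrix-valued functions and curvature of a connection *)

Section MatrixCalculus.
Variables (R : realType) (n : nat).
Implicit Types (f h : 'rV[R]_n -> R) (x y : 'rV[R]_n) (i j : 'I_n) (U : set 'rV[R]_n).

Definition diff_mx p q (A : 'rV[R]_n -> 'M[R]_(p, q)) x :=
  forall k l, differentiable (fun y => A y k l) x.

Lemma smooth_diff_mx U p q (A : 'rV[R]_n -> 'M[R]_(p, q)) x :
  smooth_mx U A -> U x -> diff_mx A x.
Proof. by move=> sA Ux k l; exact: smooth_differentiable (sA k l) Ux. Qed.

Lemma diff_mxD p q (A B : 'rV[R]_n -> 'M[R]_(p, q)) x :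
  diff_mx A x -> diff_mx B x -> diff_mx (fun y => A y + B y) x.
Proof.
move=> dA dB k l; rewrite (_ : (fun _ => _) = (fun y => A y k l) + (fun y => B y k l)).
  exact: differentiableD.
by apply/funext => y; rewrite mxE.
Qed.

Lemma diff_mxM p q r (A : 'rV[R]_n -> 'M[R]_(p, q)) (B : 'rV[R]_n -> 'M[R]_(q, r)) x :
  diff_mx A x -> diff_mx B x -> diff_mx (fun y => A y *m B y) x.
Proof.
move=> dA dB k l; rewrite (_ : (fun _ => _) = fun y => \sum_m A y k m * B y m l).
  by apply: differentiable_bigsum => m; apply: differentiableM.
by apply/funext => y; rewrite mxE.
Qed.

Lemma diff_mxT p q (A : 'rV[R]_n -> 'M[R]_(p, q)) x :
  diff_mx A x -> diff_mx (fun y => (A y)^T) x.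
Proof.
move=> dA k l; rewrite (_ : (fun _ => _) = fun y => A y l k) //.
by apply/funext => y; rewrite mxE.
Qed.

Lemma diff_mxZ p q f (A : 'rV[R]_n -> 'M[R]_(p, q)) x :
  differentiable f x -> diff_mx A x -> diff_mx (fun y => f y *: A y) x.
Proof.
move=> df dA k l; rewrite (_ : (fun _ => _) = fun y => f y * A y k l).
  exact: differentiableM.
by apply/funext => y; rewrite mxE.
Qed.

Lemma diff_mx_sum p q (I : Type) (r : seq I) (A : I -> 'rV[R]_n -> 'M[R]_(p, q)) x :
  (forall m, diff_mx (A m) x) -> diff_mx (fun y => \sum_(m <- r) A m y) x.
Proof.
move=> dA k l; rewrite (_ : (fun _ => _) = fun y => \sum_(m <- r) A m y k l).
  by apply: differentiable_bigsum => m; exact: dA.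
by apply/funext => y; rewrite summxE.
Qed.

Lemma eq_dmx U p q (A B : 'rV[R]_n -> 'M[R]_(p, q)) i x : open U -> U x ->
  (forall y, U y -> A y = B y) -> dmx i A x = dmx i B x.
Proof.
move=> oU Ux AB; apply/matrixP => k l; rewrite !mxE.
by apply: (eq_partial _ oU Ux) => y /AB ->.
Qed.

Lemma dmxE p q (A : 'rV[R]_n -> 'M[R]_(p, q)) i x k l :
  dmx i A x k l = partial i (fun y => A y k l) x.
Proof. by rewrite mxE. Qed.

Lemma partial_ext i f h x : (forall y, f y = h y) -> partial i f x = partial i h x.
Proof. by move=> /funext ->. Qed.

Lemma dmxD p q (A B : 'rV[R]_n -> 'M[R]_(p, q)) i x :
  diff_mx A x -> diff_mx B x ->
  dmx i (fun y => A y + B y) x = dmx i A x + dmx i B x.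
Proof.
move=> dA dB; apply/matrixP => k l; rewrite mx_addE !dmxE.
by apply: etrans (partialD i (dA k l) (dB k l)); apply: partial_ext => y; rewrite mxE.
Qed.

Lemma dmxM p q r (A : 'rV[R]_n -> 'M[R]_(p, q)) (B : 'rV[R]_n -> 'M[R]_(q, r)) i x :
  diff_mx A x -> diff_mx B x ->
  dmx i (fun y => A y *m B y) x = dmx i A x *m B x + A x *m dmx i B x.
Proof.
move=> dA dB; apply/matrixP => k l; rewrite mx_addE !mx_mulE -big_split dmxE.
apply: (@etrans _ _ (partial i (fun y => \sum_m A y k m * B y m l) x)).
  by apply: partial_ext => y; rewrite mxE.
rewrite partial_sum => [|m]; last exact: differentiableM (dA k m) (dB m l).
by apply: eq_bigr => m _; rewrite !dmxE; exact: partialM.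
Qed.

Lemma dmxT p q (A : 'rV[R]_n -> 'M[R]_(p, q)) i x :
  dmx i (fun y => (A y)^T) x = (dmx i A x)^T.
Proof.
apply/matrixP => k l; rewrite mx_trE !dmxE.
by apply: partial_ext => y; rewrite mxE.
Qed.

Lemma dmxZ p q f (A : 'rV[R]_n -> 'M[R]_(p, q)) i x :
  differentiable f x -> diff_mx A x ->
  dmx i (fun y => f y *: A y) x = partial i f x *: A x + f x *: dmx i A x.
Proof.
move=> df dA; apply/matrixP => k l; rewrite mx_addE !mx_scaleE !dmxE.
by apply: etrans (partialM i df (dA k l)); apply: partial_ext => y; rewrite mxE.
Qed.

Lemma dmx_sum p q (I : Type) (r : seq I) (A : I -> 'rV[R]_n -> 'M[R]_(p, q)) i x :
  (forall m, diff_mx (A m) x) ->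
  dmx i (fun y => \sum_(m <- r) A m y) x = \sum_(m <- r) dmx i (A m) x.
Proof.
move=> dA; apply/matrixP => k l; rewrite summxE dmxE.
apply: (@etrans _ _ (partial i (fun y => \sum_(m <- r) A m y k l) x)).
  by apply: partial_ext => y; rewrite summxE.
rewrite partial_sum => [|m]; last exact: dA.
by apply: eq_bigr => m _; rewrite dmxE.
Qed.

Lemma dmx_comm U p q (A : 'rV[R]_n -> 'M[R]_(p, q)) i j x :
  open U -> smooth_mx U A -> U x ->
  dmx i (dmx j A) x = dmx j (dmx i A) x.
Proof.
move=> oU sA Ux; apply/matrixP => k l.
have E a b : dmx a (dmx b A) x k l = partial a (partial b (fun y => A y k l)) x.
  exact: etrans (dmxE _ _ _ _ _) (partial_ext a x (fun y => dmxE A b y k l)).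
exact: etrans (E i j) (etrans (partial_comm i j oU (sA k l) Ux) (esym (E j i))).
Qed.

Lemma differentiable_rV m (F : 'rV[R]_n -> 'rV[R]_m) x :
  (forall k, differentiable (fun y => F y 0 k) x) -> differentiable F x.
Proof.
move=> dF; rewrite (_ : F = fun y => \sum_k F y 0 k *: delta_mx 0 k); last first.
  by apply/funext => y; exact: row_sum_delta.
elim: (index_enum _) => [|k r IHr].
  rewrite (_ : (fun _ => _) = cst 0); first exact: differentiable_cst.
  by apply/funext => y; rewrite big_nil.
rewrite (_ : (fun _ => _) = (fun y => F y 0 k *: delta_mx 0 k) +
    (fun y => \sum_(k <- r) F y 0 k *: delta_mx 0 k)).
  by apply: differentiableD => //; exact: differentiableZl.
by apply/funext => y; rewrite big_cons.
Qed.

Lemma jacobianE m (F : 'rV[R]_n -> 'rV[R]_m) x i k : differentiable F x ->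
  ('J F x) i k = partial i (fun y => F y 0 k) x.
Proof.
move=> dF; have := deriveEjacobian (delta_mx 0 i) dF.
rewrite derive_mx; last exact: diff_derivable.
by rewrite -rowE => /rowP/(_ k); rewrite !mxE => <-.
Qed.

Lemma partial_comp m (F : 'rV[R]_n -> 'rV[R]_m) (f : 'rV[R]_m -> R) x i :
  differentiable F x -> differentiable f (F x) ->
  partial i (fun y => f (F y)) x = \sum_k ('J F x) i k * partial k f (F x).
Proof.
move=> dF df; rewrite /partial deriveE; last exact: differentiable_comp.
rewrite (diff_comp dF df) /= -deriveE // derive_partial //.
apply: eq_bigr => k _; rewrite -deriveE // deriveEjacobian // -rowE mxE.
by [].
Qed.

Lemma diff_mx_comp p q (F : 'rV[R]_n -> 'rV[R]_n) (A : 'rV[R]_n -> 'M[R]_(p, q)) x :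
  differentiable F x -> diff_mx A (F x) -> diff_mx (fun y => A (F y)) x.
Proof.
by move=> dF dA k l; apply: (@differentiable_comp _ _ _ _ F (fun y => A y k l)) dF (dA k l).
Qed.

Lemma dmx_comp p q (F : 'rV[R]_n -> 'rV[R]_n) (A : 'rV[R]_n -> 'M[R]_(p, q)) x i :
  differentiable F x -> diff_mx A (F x) ->
  dmx i (fun y => A (F y)) x = \sum_k ('J F x) i k *: dmx k A (F x).
Proof.
move=> dF dA; apply/matrixP => k l; rewrite summxE dmxE.
apply: etrans (partial_comp i dF (dA k l)) _.
by apply: eq_bigr => m _; rewrite mx_scaleE dmxE.
Qed.

End MatrixCalculus.

Lemma trmxD (V : nmodType) p q (A B : 'M[V]_(p, q)) : (A + B)^T = A^T + B^T.
Proof. by apply/matrixP => k l; rewrite !mxE. Qed.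

Lemma trmxN (V : zmodType) p q (A : 'M[V]_(p, q)) : (- A)^T = - A^T.
Proof. by apply/matrixP => k l; rewrite !mxE. Qed.

Lemma trmxZ (R : pzRingType) p q c (A : 'M[R]_(p, q)) : (c *: A)^T = c *: A^T.
Proof. by apply/matrixP => k l; rewrite !mxE. Qed.

(* Expands both sides into monomials in *m and compares them entrywise. *)
Ltac mxnorm :=
  rewrite ?(trmxD, trmxN, trmxZ, trmx_mul);
  rewrite ?(mulmxDl, mulmxDr, mulNmx, mulmxN);
  rewrite -?(scalemxAl, scalemxAr) ?mulmxA;
  apply/matrixP => ? ?; rewrite ?(mx_addE, mx_oppE, mx_scaleE).
Ltac mxring := mxnorm; ring.
(** With [dAij] for d_i A_j and [dbij] for d_i b_j, the two brackets are the product-rule expansions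
    of d_i d_j T and d_j d_i T. The terms A_i T A_j^T, b_i A_j T, b_i T A_j^T and b_i b_j T occur
    symmetrically in i, j and cancel. *)
Lemma ricci_identity_algebra (R : comPzRingType) n (Ai Aj dAij dAji T : 'M[R]_n) (bi bj dbij dbji : R) :
  let Ti := Ai *m T + T *m Ai^T + bi *: T in
  let Tj := Aj *m T + T *m Aj^T + bj *: T in
  let O := dAij - dAji + Aj *m Ai - Ai *m Aj in
  O *m T + T *m O^T + (dbij - dbji) *: T =
  (dAij *m T + Aj *m Ti + (Ti *m Aj^T + T *m dAij^T) + (dbij *: T + bj *: Ti)) - 
  (dAji *m T + Ai *m Tj + (Tj *m Ai^T + T *m dAji^T) + (dbji *: T + bi *: Tj)).
Proof.
move=> Ti Tj O; rewrite /Ti /Tj /O. mxring.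
Qed.

Section Curvature.
Variables (R : realType) (n : nat).
Implicit Types (f h : 'rV[R]_n -> R) (x y : 'rV[R]_n) (i j : 'I_n) (U : set 'rV[R]_n).

(** Minus the commutator of the operators d_i - A_i and d_j - A_j acting on columns; hence the sign
    of the quadratic terms. *)
Definition curv (A : 'I_n -> 'rV[R]_n -> 'M[R]_n) i j x : 'M[R]_n :=
  dmx i (A j) x - dmx j (A i) x + A j x *m A i x - A i x *m A j x.

Lemma curv_def (A : 'I_n -> 'rV[R]_n -> 'M[R]_n) i j x : curv A i j x =
  dmx i (A j) x - dmx j (A i) x + A j x *m A i x - A i x *m A j x.
Proof. by []. Qed.

Lemma curv_antisym (A : 'I_n -> 'rV[R]_n -> 'M[R]_n) i j x : curv A j i x = - curv A i j x.
Proof. by rewrite /curv; mxring. Qed.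

(* d_i and d_j commute on T, so that nabla T = b T forces the curvature to act
   on T through db. *)
Lemma ricci_identity U (A : 'I_n -> 'rV[R]_n -> 'M[R]_n) (T : 'rV[R]_n -> 'M[R]_n)
    (b : 'I_n -> 'rV[R]_n -> R) :
  open U -> (forall i, smooth_mx U (A i)) -> smooth_mx U T ->
  (forall i, smooth_on U (b i)) ->
  (forall i y, U y -> dmx i T y = A i y *m T y + T y *m (A i y)^T + b i y *: T y) ->
  forall i j x, U x ->
  curv A i j x *m T x + T x *m (curv A i j x)^T
    + (partial i (b j) x - partial j (b i) x) *: T x = 0.
Proof.
move=> oU sA sT sb dT i j x Ux.
have E k l : dmx k (dmx l T) x = dmx k (A l) x *m T x + A l x *m dmx k T x
    + (dmx k T x *m (A l x)^T + T x *m (dmx k (A l) x)^T)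
    + (partial k (b l) x *: T x + b l x *: dmx k T x).
  rewrite (eq_dmx _ oU Ux (dT l)).
  have dA := smooth_diff_mx (sA l) Ux; have dAT := diff_mxT dA.
  have d := smooth_diff_mx sT Ux; have db := smooth_differentiable (sb l) Ux.
  rewrite dmxD; [|exact: diff_mxD (diff_mxM dA d) (diff_mxM d dAT)|exact: diff_mxZ].
  rewrite dmxD; [|exact: diff_mxM|exact: diff_mxM].
  by rewrite !dmxM // dmxZ // dmxT.
have := dmx_comm i j oU sT Ux.
rewrite !E !dT // => /eqP; rewrite -subr_eq0 => /eqP <-.
exact: ricci_identity_algebra.
Qed.

End Curvature.

(** * Algebra in one tangent space *)

Section PointwiseAlgebra.
Variables (R : realType) (n : nat).
Implicit Types (g Ric : 'M[R]_n) (alpha beta : 'rV[R]_n) (i j l : 'I_n).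

Lemma posdef_unitmx g :
  (forall v : 'rV[R]_n, v != 0 -> 0 < (v *m g *m v^T) 0 0) -> g \in unitmx.
Proof.
move=> gp; rewrite -row_free_unit -kermx_eq0; apply/eqP/row_matrixP => i.
rewrite row0; apply/eqP/negPn/negP => /gp.
have /sub_kermxP -> : (row i (kermx g) <= kermx g)%MS by exact: row_sub.
by rewrite mul0mx mxE ltxx.
Qed.

(** Fix p with alpha_p nonzero. Evaluating the identity at triples containing p determines column p
    of [Ric], then all of [Ric], with c = Ric_pp / alpha_p^2; if Ric_pp = 0, column p vanishes and
    so does [Ric]. *)
Lemma pseudo_symmetric_rank_one Ric alpha beta :
  Ric^T = Ric -> alpha != 0 ->
  (forall i j l, beta 0 l * Ric i j =
     2 * alpha 0 l * Ric i j + alpha 0 i * Ric l j + alpha 0 j * Ric i l) ->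
  exists c, Ric = c *: (alpha^T *m alpha).
Proof.
move=> Rs al0 psym.
have {}Rs i j : Ric i j = Ric j i by rewrite -[in LHS]Rs mxE.
have /rV0Pn[p ap] := al0.
pose gamma l := beta 0 l - 2 * alpha 0 l.
have {}psym i j l : gamma l * Ric i j = alpha 0 i * Ric l j + alpha 0 j * Ric i l.
  by rewrite /gamma mulrBl psym; ring.
pose r := Ric p p; pose a := alpha 0 p.
have [r0|r0] := eqVneq r 0.
  have Rp l : Ric l p = 0.
    have := psym p p l; rewrite -/r r0 mulr0 (Rs p l) => e.
    by apply: (mulfI ap); rewrite mulr0; lra.
  exists 0; rewrite scale0r; apply/matrixP => i l; rewrite mxE.
  have := psym i p l; rewrite !Rp !mulr0 add0r => e.
  by apply: (mulfI ap); rewrite mulr0.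
have gap : gamma p = 2 * a.
  by apply: (mulIf r0); rewrite /r psym /a; ring.
have Rp l : 2 * a * Ric l p = gamma l * r.
  by rewrite /r psym (Rs p l) /a; ring.
(* Equivalently, beta = 4 alpha. *)
have gaal l : gamma l = 2 * alpha 0 l.
  apply: (mulIf r0); apply: (mulfI ap).
  have e1 := psym p l p; have e2 := psym l p p; have e3 := Rp l; have e4 := psym p p l.
  have := psym l p p; rewrite gap -!/r -!/a => e.
  have h : a * Ric l p = alpha 0 l * r by move: e; rewrite -/a; lra.
  by rewrite -/a -e3; transitivity (2 * a * (a * Ric l p)); [ring|rewrite h; ring].
have {}Rp l : a * Ric l p = alpha 0 l * r.
  have two : (2 : R) != 0 by rewrite pnatr_eq0.
  by apply: (mulfI two); rewrite mulrA Rp gaal; ring.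
exists (r / a ^+ 2); apply/matrixP => i j.
rewrite mxE mx_mulE big_ord_recl big_ord0 addr0 mx_trE.
have := psym i j p; rewrite gap (Rs p j) -/a => e.
have e2 : 2 * (a * a) * Ric i j = 2 * (alpha 0 i * alpha 0 j * r).
  transitivity (a * (2 * a * Ric i j)); first by ring.
  rewrite e mulrDr; transitivity (alpha 0 i * (a * Ric j p) + alpha 0 j * (a * Ric i p)); first by ring.
  by rewrite !Rp; ring.
apply: (mulfI (_ : 2 * (a * a) != 0)).
  by rewrite !mulf_neq0 // pnatr_eq0.
by rewrite e2; field.
Qed.

(** At p with alpha_p nonzero, the diagonal entry (p, p) gives w_p = 0, and column p then gives the
    other entries. *)
Lemma outer_sym_eq0 (w : 'cV[R]_n) alpha : alpha != 0 ->
  w *m alpha + alpha^T *m w^T = 0 -> w = 0.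
Proof.
move=> al0 e.
have {}e i j : w i 0 * alpha 0 j + alpha 0 i * w j 0 = 0.
  have /matrixP/(_ i j) := e; rewrite mx_addE !mx_mulE !big_ord_recl !big_ord0 !addr0.
  by rewrite !mx_trE mxE.
have /rV0Pn[p ap] := al0.
have wp : w p 0 = 0.
  by apply: (mulfI ap); have := e p p; rewrite mulr0 => ?; lra.
apply/colP => i; rewrite mxE; apply: (mulIf ap).
by have := e i p; rewrite wp mulr0 addr0 mul0r.
Qed.

(* Om l j is the curvature operator R(d_l, d_j), skew with respect to g, and om
   the exterior derivative of the recurrence form. Pseudo symmetry makes Ric a
   multiple of alpha^T *m alpha; tracing against g^-1 gives om = 0, so every
   Om l j kills alpha, hence so does Ric. *)
Lemma recurrent_pseudo_symmetric_eq0 g Ric alpha beta (Om : 'I_n -> 'I_n -> 'M[R]_n)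
    (om : 'I_n -> 'I_n -> R) :
  g^T = g -> (forall v : 'rV[R]_n, v != 0 -> 0 < (v *m g *m v^T) 0 0) ->
  (forall i j, Om i j *m g + g *m (Om i j)^T = 0) ->
  (forall i j, Ric i j = \sum_l Om l j i l) -> Ric^T = Ric ->
  (forall i j, Om i j *m Ric + Ric *m (Om i j)^T + om i j *: Ric = 0) ->
  (forall i j l, beta 0 l * Ric i j =
     2 * alpha 0 l * Ric i j + alpha 0 i * Ric l j + alpha 0 j * Ric i l) ->
  alpha != 0 -> Ric = 0.
Proof.
move=> gs gp Og RE Rs RI psym al0.
have gu := posdef_unitmx gp.
have [c Rc] := pseudo_symmetric_rank_one Rs al0 psym.
have [c0|c0] := eqVneq c 0; first by rewrite Rc c0 scale0r.
exfalso.
have gVs : (invmx g)^T = invmx g by rewrite trmx_inv gs.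
(* [v] is the vector alpha^#. *)
pose v := alpha *m invmx g.
have vg : v *m g = alpha by rewrite /v mulmxKV.
have vT : v^T = invmx g *m alpha^T by rewrite trmx_mul gVs.
have v0 : v != 0 by apply: contra_neq al0 => v0; rewrite -vg v0 mul0mx.
have av : 0 < (alpha *m v^T) 0 0 by rewrite -[X in X *m _]vg gp.
have gO i j : invmx g *m Om i j = - ((Om i j)^T *m invmx g).
  have /eqP := Og i j; rewrite addr_eq0 => /eqP e.
  by rewrite -[in LHS](mulmxK gu (Om i j)) e mulNmx mulmxN !mulmxA mulVmx // mul1mx.
have om0 i j : om i j = 0.
  have := congr1 (fun A => \tr (invmx g *m A)) (RI i j).
  rewrite mulmx0 mxtrace0 !mulmxDr !mxtraceD mulmxA gO mulNmx raddfN /=.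
  rewrite -scalemxAr mxtraceZ [X in - \tr X](_ : _ = (Om i j)^T *m (invmx g *m Ric)); last first.
    by rewrite mulmxA.
  rewrite mxtrace_mulC -mulmxA addNr add0r => /eqP.
  rewrite mulf_eq0 => /orP[/eqP // |]; rewrite Rc -scalemxAr mxtraceZ mulf_eq0 (negPf c0) /=.
  by rewrite mulmxA mxtrace_mulC -vT trace_mx11 (gt_eqF av).
have Oa i j : Om i j *m alpha^T = 0.
  apply: (outer_sym_eq0 al0).
  have := RI i j; rewrite om0 scale0r addr0 Rc -scalemxAl -scalemxAr -scalerDr.
  move=> /eqP; rewrite scaler_eq0 (negPf c0) /= => /eqP.
  by rewrite trmx_mul trmxK !mulmxA.
have vO i j : v *m Om i j = 0.
  rewrite /v -mulmxA gO mulmxN mulmxA -[alpha]trmxK -trmx_mul Oa.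
  by rewrite trmx0 mul0mx oppr0.
have vR : v *m Ric = 0.
  apply/rowP => j; rewrite mx_mulE mxE.
  (* Regrouped, entry j of v Ric is the sum over l of entry l of v Om_lj. *)
  under eq_bigr do rewrite RE mulr_sumr.
  rewrite exchange_big big1 // => l _ /=.
  by have /rowP/(_ l) := vO l j; rewrite mx_mulE mxE.
have : v *m Ric *m v^T = 0 by rewrite vR mul0mx.
rewrite Rc -scalemxAr -scalemxAl mulmxA -[v *m _ *m _ *m _]mulmxA.
move=> /matrixP/(_ 0 0).
rewrite mx_scaleE mx_mulE big_ord_recl big_ord0 addr0 [RHS]mxE.
have -> : v *m alpha^T = (alpha *m v^T)^T by rewrite trmx_mul trmxK.
move/eqP; rewrite mx_trE !mulf_eq0 (negPf c0) /=.
by rewrite (gt_eqF av).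
Qed.

End PointwiseAlgebra.

(** * Entries of matrix commutators *)

Lemma commutator_entry (R : pzRingType) n (P Q B C : 'M[R]_n) k l :
  (P - Q + B *m C - C *m B) k l =
  P k l - Q k l + \sum_m B k m * C m l - \sum_m C k m * B m l.
Proof. by rewrite !(mx_addE, mx_oppE) !mx_mulE. Qed.

Lemma eq_commutator_entry (R : pzRingType) (I : finType) (u v u' v' : R)
    (P Q S T : I -> R) :
  u = u' -> v = v' -> (forall m, P m = S m) -> (forall m, Q m = T m) ->
  u - v + \sum_m (P m - Q m) = u' - v' + \sum_m S m - \sum_m T m.
Proof.
by move=> -> -> PS QT; rewrite sumrB addrA (eq_bigr _ (fun m _ => PS m)) (eq_bigr _ (fun m _ => QT m)).
Qed.

(** The skeleton of the first Bianchi identity: the [a]'s stand for derivatives of connection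
    entries, the sums for the quadratic terms, and torsion-freeness supplies the equalities that
    pair them off. *)
Lemma cyclic_commutator_entries (R : comPzRingType) (I : finType) (a1 a2 a3 a4 a5 a6 : R)
    (P P' Q Q' S S' : I -> R) :
  a1 = a6 -> a2 = a3 -> a4 = a5 -> P =1 P' -> Q =1 Q' -> S =1 S' ->
  (a1 - a2 + \sum_m P m - \sum_m Q m) + (a3 - a4 + \sum_m Q' m - \sum_m S m)
    + (a5 - a6 + \sum_m S' m - \sum_m P' m) = 0.
Proof.
move=> -> -> -> PP QQ SS.
rewrite (eq_bigr P' (fun m _ => PP m)) (eq_bigr Q' (fun m _ => QQ m)).
by rewrite (eq_bigr S' (fun m _ => SS m)); ring.
Qed.

Lemma curvE (R : realType) n (A : 'I_n -> 'rV[R]_n -> 'M[R]_n) i j x k l :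
  curv A i j x k l = dmx i (A j) x k l - dmx j (A i) x k l
    + \sum_m A j x k m * A i x m l - \sum_m A i x k m * A j x m l.
Proof. exact: commutator_entry. Qed.

(** * The Levi-Civita connection in a chart *)

Section LocalConnection.
Variables (R : realType) (n : nat) (G : 'rV[R]_n -> 'M[R]_n).
Implicit Types (x y : 'rV[R]_n) (i j l : 'I_n) (U : set 'rV[R]_n).

(* With A_i := conn i, covectors satisfy nabla_i w = d_i w - w *m A_i^T and
   2-tensors nabla_i T = d_i T - A_i *m T - T *m A_i^T. *)
Definition conn i x : 'M[R]_n := \matrix_(j, k) christoffel G k i j x.

Lemma connE i x j k : conn i x j k = christoffel G k i j x.
Proof. by rewrite mxE. Qed.

Lemma riemannE l k i j x : riemann G l k i j x = curv conn i j x k l.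
Proof.
have d p q : dmx p (conn q) x k l = partial p (christoffel G l q k) x.
  by apply: etrans (dmxE _ _ _ _ _) _; apply: partial_ext => y; rewrite connE.
apply: etrans (eq_commutator_entry (esym (d i j)) (esym (d j i)) _ _) (esym (curvE _ _ _ _ _ _)).
  by move=> m; rewrite !connE; exact: mulrC.
by move=> m; rewrite !connE; exact: mulrC.
Qed.

Lemma ricciE x i j : ricci G x i j = \sum_l curv conn l j x i l.
Proof. by rewrite mxE; apply: eq_bigr => l _; rewrite riemannE. Qed.

Lemma cov_derivE (T : 'rV[R]_n -> 'M[R]_n) i j l x : cov_deriv G T i j l x =
  (dmx l T x - (conn l x *m T x + T x *m (conn l x)^T)) i j.
Proof.
rewrite mx_addE mx_oppE mx_addE !mx_mulE dmxE -big_split; congr (_ - _).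
by apply: eq_bigr => m _; rewrite mx_trE !connE [T x i m * _]mulrC.
Qed.

Section SmoothLocal.
Variable U : set 'rV[R]_n.
Hypotheses (oU : open U) (Gs : smooth_mx U G) (Gu : forall x, U x -> G x \in unitmx).

Lemma smooth_conn i : smooth_mx U (conn i).
Proof.
move=> j k.
apply: (eq_smooth oU (f := christoffel G k i j)) => [x _|]; first by rewrite connE.
apply: smoothM => //; first exact: smooth_cst.
apply: smooth_sum => // l; apply: smoothM => //; first exact: smooth_invmx.
by apply: smoothB => //; first apply: smoothD => //; apply: smooth_partial; exact: Gs.
Qed.

Lemma smooth_curv i j : smooth_mx U (curv conn i j).
Proof.
apply: smoothmxB => //; last by apply: smooth_mulmx => //; exact: smooth_conn.
apply: smoothmxD => //; last by apply: smooth_mulmx => //; exact: smooth_conn.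
by apply: smoothmxB => //; apply: smooth_dmx => //; exact: smooth_conn.
Qed.

Lemma smooth_ricci : smooth_mx U (ricci G).
Proof.
move=> i j; apply: (eq_smooth oU (f := fun x => \sum_l curv conn l j x i l)) => [x _|].
  by rewrite ricciE.
by apply: smooth_sum => // l; exact: smooth_curv.
Qed.

End SmoothLocal.
End LocalConnection.


(* Keeps failing unifications from unfolding derivatives down to limits. *)
Local Opaque partial dmx curv conn christoffel.

(** * Symmetries of the curvature in a chart *)

Section ChartGeometry.
Variables (R : realType) (n : nat) (M : manifold R n) (g : metric M).
Variable a : chart_index M.
Implicit Types (x y : 'rV[R]_n) (i j l : 'I_n).
Let U := chart_img (atlas a).
Let oU : open U. Proof. exact: chart_img_open. Qed.
Let A := conn (g a).

Lemma metric_unit x : U x -> g a x \in unitmx.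
Proof. by move=> /(metric_pos g) gp; exact: posdef_unitmx. Qed.

Lemma smooth_metric : smooth_mx U (g a).
Proof. by move=> i j; exact: metric_smooth. Qed.

Lemma smooth_metric_conn i : smooth_mx U (A i).
Proof. by apply: smooth_conn => //; [exact: smooth_metric|exact: metric_unit]. Qed.

Lemma smooth_metric_ricci : smooth_mx U (ricci (g a)).
Proof. by apply: smooth_ricci => //; [exact: smooth_metric|exact: metric_unit]. Qed.

Lemma conn_torsion_free x i j k : U x -> A i x j k = A j x i k.
Proof. by move=> Ux; rewrite !connE; exact: christoffel_torsion_free. Qed.

Lemma conn_metric i x : U x -> dmx i (g a) x = A i x *m g a x + g a x *m (A i x)^T.
Proof.
move=> Ux; apply/eqP; rewrite -subr_eq0; apply/eqP/matrixP => k l.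
by rewrite -cov_derivE (christoffel_metric g Ux) mxE.
Qed.

(** Metric compatibility is the hypothesis of [ricci_identity] with T = g and b = 0. *)
Lemma curv_metric i j x : U x ->
  curv A i j x *m g a x + g a x *m (curv A i j x)^T = 0.
Proof.
move=> Ux.
have h : forall k y, U y ->
    dmx k (g a) y = A k y *m g a y + g a y *m (A k y)^T + 0 *: g a y.
  by move=> k y Uy; rewrite scale0r addr0; exact: conn_metric.
have := ricci_identity oU smooth_metric_conn smooth_metric
  (fun k => smooth_cst oU 0) h i j Ux.
by rewrite !partial_cst subrr scale0r addr0.
Qed.

(** Multiplying the skewness relation by g^-1 and taking the trace gives twice the trace of the
    curvature. *)
Lemma curv_trace0 i j x : U x -> \tr (curv A i j x) = 0.
Proof.
move=> Ux; have gu := metric_unit Ux.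
have := congr1 (fun B => \tr (B *m invmx (g a x))) (curv_metric i j Ux).
rewrite mul0mx mxtrace0 mulmxDl mxtraceD mulmxK // mxtrace_mulC mulmxA mulVmx //.
by rewrite mul1mx mxtrace_tr => ?; lra.
Qed.

Lemma dmx_conn_torsion_free p i j k x : U x ->
  dmx p (A i) x j k = dmx p (A j) x i k.
Proof.
move=> Ux; apply: etrans (dmxE _ _ _ _ _) (etrans _ (esym (dmxE _ _ _ _ _))).
by apply: (eq_partial _ oU Ux) => y Uy; exact: conn_torsion_free.
Qed.

Lemma add3_eq0 (V : nmodType) (u v w u' v' w' : V) :
  u = u' -> v = v' -> w = w' -> u' + v' + w' = 0 -> u + v + w = 0.
Proof. by move=> -> -> ->. Qed.

Lemma first_bianchi i j k l x : U x ->
  curv A i j x k l + curv A j k x i l + curv A k i x j l = 0.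
Proof.
move=> Ux.
apply: add3_eq0 (curvE A i j x k l) (curvE A j k x i l) (curvE A k i x j l) _.
apply: cyclic_commutator_entries; try exact: dmx_conn_torsion_free.
- by move=> m; rewrite (conn_torsion_free j k).
- by move=> m; rewrite (conn_torsion_free i k).
- by move=> m; rewrite (conn_torsion_free j i).
Qed.

(** The first Bianchi identity contracted over l: its middle term is a trace, hence 0, and the outer
    ones are Ric_ij and - Ric_ji. *)
Lemma ricci_sym x : U x -> (ricci (g a) x)^T = ricci (g a) x.
Proof.
move=> Ux; apply/matrixP => j i; rewrite mx_trE !ricciE -/A.
have : \sum_l (curv A l j x i l + curv A j i x l l + curv A i l x j l) = 0.
  by apply: big1 => l _; exact: first_bianchi.
rewrite !big_split /=.
have t0 : \sum_l curv A j i x l l = 0 by exact: curv_trace0.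
have e : \sum_l curv A i l x j l = - \sum_l curv A l i x j l.
  rewrite -sumrN; apply: eq_bigr => l _.
  exact: etrans (congr1 (fun B : 'M[R]_n => B j l) (curv_antisym A l i x)) (mx_oppE _ _ _).
have add3 (u v w z : R) : v = 0 -> w = - z -> u + v + w = 0 -> u = z.
  by move=> -> ->; rewrite addr0 => /eqP; rewrite subr_eq0 => /eqP.
exact: add3 t0 e.
Qed.

End ChartGeometry.

(** * Change of chart *)

(* With J the Jacobian of a change of coordinates and P the connection pulled
   back along it, A J = dJ + J P; the J-derivative terms cancel in the
   curvature. *)
Lemma gauge_curvature_algebra (R : comPzRingType) n
    (J Ai Aj Pi Pj Ji Jj Jij dAij dAji dPij dPji : 'M[R]_n) :
  Ai *m J = Ji + J *m Pi -> Aj *m J = Jj + J *m Pj ->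
  dAij *m J + Aj *m Ji = Jij + (Ji *m Pj + J *m dPij) ->
  dAji *m J + Ai *m Jj = Jij + (Jj *m Pi + J *m dPji) ->
  (dAij - dAji + Aj *m Ai - Ai *m Aj) *m J =
  J *m (dPij - dPji + Pj *m Pi - Pi *m Pj).
Proof.
move=> ei ej eij eji.
have {}ei : Ji = Ai *m J - J *m Pi by rewrite ei addrK.
have {}ej : Jj = Aj *m J - J *m Pj by rewrite ej addrK.
have {}eij : dAij *m J = Jij + (Ji *m Pj + J *m dPij) - Aj *m Ji by rewrite -eij addrK.
have {}eji : dAji *m J = Jij + (Jj *m Pi + J *m dPji) - Ai *m Jj by rewrite -eji addrK.
transitivity (dAij *m J - dAji *m J + Aj *m Ai *m J - Ai *m Aj *m J); first by mxring.
by rewrite eij eji ei ej; mxring.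
Qed.

Lemma scaler_sum_commutator (R : pzRingType) (V : lmodType R) (I : finType) (u : V)
    (c : I -> I -> R) (P Q S T : I -> I -> V) :
  u + \sum_k \sum_l c k l *: P k l - (u + \sum_k \sum_l c k l *: Q k l)
    + \sum_k \sum_l c k l *: S k l - \sum_k \sum_l c k l *: T k l =
  \sum_k \sum_l c k l *: (P k l - Q k l + S k l - T k l).
Proof.
rewrite opprD addrACA subrr add0r -sumrB -big_split -sumrB; apply: eq_bigr => k _ /=.
rewrite -sumrB -big_split -sumrB; apply: eq_bigr => l _ /=.
by rewrite -scalerBr -scalerDr -scalerBr.
Qed.

Section Transition.
Variables (R : realType) (n : nat) (M : manifold R n) (g : metric M).
Variables a b : chart_index M.
Implicit Types (x y : 'rV[R]_n) (i j k l : 'I_n).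
Let V := overlap (atlas a) (atlas b).
Let F := transition (atlas a) (atlas b).
Let J y := 'J F y.
Let A := conn (g a).
Let B := conn (g b).

Lemma overlap_img x : V x -> chart_img (atlas a) x.
Proof. by move=> [p [ap _] <-]; exists p. Qed.

Lemma transition_img x : V x -> chart_img (atlas b) (F x).
Proof. by move=> [p [ap bp] <-]; exists p; rewrite // /F /transition /= chart_mapK. Qed.

(** [chart_inv] is known to be continuous only at points of the chart image, so openness is checked
    point by point. *)
Lemma overlap_open : open V.
Proof.
have -> : V = [set x | chart_img (atlas a) x /\ chart_dom (atlas b) (chart_inv (atlas a) x)].
  apply/seteqP; split => [x [p [ap bp] <-]|x [[p ap <-]]] /=.
    by split; [exists p|rewrite chart_mapK].
  by rewrite chart_mapK // => bp; exists p.
rewrite openE => x [ax bx].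
have nb : nbhs x (chart_inv (atlas a) @^-1` chart_dom (atlas b)).
  apply: (chart_inv_cont ax); apply: open_nbhs_nbhs; split=> //.
  exact: chart_dom_open.
have na : nbhs x (chart_img (atlas a)).
  by apply: open_nbhs_nbhs; split => //; exact: chart_img_open.
by apply: filterS2 na nb => y.
Qed.

Lemma transition_smooth k : smooth_on V (fun x => F x 0 k).
Proof. exact: atlas_smooth. Qed.

Lemma transition_differentiable x : V x -> differentiable F x.
Proof.
by move=> Vx; apply: differentiable_rV => k; exact: smooth_differentiable (transition_smooth k) Vx.
Qed.

Lemma transition_jacobianE x i k : V x -> J x i k = partial i (fun y => F y 0 k) x.
Proof. by move=> Vx; exact/jacobianE/transition_differentiable. Qed.

Lemma smooth_jacobian : smooth_mx V J.
Proof.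
move=> i k; apply: eq_smooth overlap_open _ (smooth_partial i (transition_smooth k)).
by move=> x Vx; rewrite transition_jacobianE.
Qed.

Lemma dmx_jacobianC i j k x : V x -> dmx i J x j k = dmx j J x i k.
Proof.
move=> Vx.
have E p q : dmx p J x q k = partial p (partial q (fun y => F y 0 k)) x.
  apply: etrans (dmxE _ _ _ _ _) _; apply: (eq_partial _ overlap_open Vx) => y Vy.
  exact: transition_jacobianE.
exact: etrans (E i j) (etrans (partial_comm i j overlap_open (transition_smooth k) Vx) (esym (E j i))).
Qed.

(** Read off from g_a = J g_b J^T, whose left side is invertible. *)
Lemma jacobian_unit x : V x -> J x \in unitmx.
Proof.
move=> Vx; have := metric_unit g (overlap_img Vx).
by rewrite (metric_transform g Vx) !unitmx_mul => /andP[/andP[]].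
Qed.

Let pull i y : 'M[R]_n := \sum_k J y i k *: B k (F y).
Let frame i y : 'M[R]_n := dmx i J y + J y *m pull i y.

Lemma pull_diff_mx i x : V x -> diff_mx (pull i) x.
Proof.
move=> Vx; apply: diff_mx_sum => k; apply: diff_mxZ.
  exact: smooth_differentiable (smooth_jacobian i k) Vx.
apply: diff_mx_comp; first exact: transition_differentiable.
exact: smooth_diff_mx (smooth_metric_conn (a := b) g k) (transition_img Vx).
Qed.

Lemma dmx_metric_transition i x : V x ->
  dmx i (g a) x = frame i x *m g b (F x) *m (J x)^T + J x *m g b (F x) *m (frame i x)^T.
Proof.
move=> Vx.
have dF := transition_differentiable Vx.
have dJ := smooth_diff_mx smooth_jacobian Vx.
have dg : diff_mx (g b) (F x) := smooth_diff_mx (smooth_metric (a := b) g) (transition_img Vx).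
have dgF := diff_mx_comp dF dg.
rewrite (eq_dmx i overlap_open Vx (fun y Vy => metric_transform g Vy)).
rewrite (dmxM i (diff_mxM dJ dgF) (diff_mxT dJ)) (dmxM i dJ dgF) (dmxT J).
rewrite (dmx_comp i dF dg).
have -> : \sum_k ('J F x) i k *: dmx k (g b) (F x) =
    pull i x *m g b (F x) + g b (F x) *m (pull i x)^T.
  rewrite /pull mulmx_suml linear_sum mulmx_sumr -big_split.
  apply: eq_bigr => k _; rewrite (conn_metric g k (transition_img Vx)) /=.
  by rewrite scalerDr scalemxAl linearZ scalemxAr.
rewrite -/(J x) /frame; set d := dmx i J x; set P := pull i x.
move: (J x) (g b (F x)) d P => J0 G0 d P; mxring.
Qed.

(** The candidate C_i = (d_i J + J P_i) J^-1 is symmetric in its lower indices and compatible with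
    g_a, so [levi_civita_unique] forces A_i = C_i. *)
Lemma conn_transition i x : V x -> A i x *m J x = frame i x.
Proof.
move=> Vx; have Ju := jacobian_unit Vx.
pose C i := frame i x *m invmx (J x).
have CJ k : C k *m J x = frame k x by rewrite mulmxKV.
suff -> : A i x = C i by [].
apply/matrixP => j k; rewrite connE; apply/esym.
apply: (levi_civita_unique (overlap_img Vx) (Gam := fun k i j => C i j k)) => [q p r|p q r].
  (* Multiplying by J^-1 on the right keeps rows apart, so the symmetry can be checked on [frame]:
     mixed partials of F commute and the connection of chart b is torsion-free. *)
  suff e : row r (frame p x) = row p (frame r x).
    have /rowP/(_ q) : row r (C p) = row p (C r) by rewrite !row_mul e.
    by rewrite !mxE.
  apply/rowP => s; rewrite [LHS]mxE [RHS]mxE /frame 2!mx_addE; congr (_ + _).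
    exact: dmx_jacobianC.
  rewrite /pull !mx_mulE.
  under eq_bigr do rewrite summxE mulr_sumr.
  rewrite exchange_big /=; apply: eq_bigr => k' _.
  rewrite summxE mulr_sumr; apply: eq_bigr => l _; rewrite !mx_scaleE.
  by rewrite (conn_torsion_free g k' l s (transition_img Vx)) mulrCA.
apply: etrans (esym (dmxE _ _ _ _ _)) _.
rewrite (dmx_metric_transition r Vx) -!CJ.
have -> : C r *m J x *m g b (F x) *m (J x)^T = C r *m g a x.
  by rewrite (metric_transform g Vx) !mulmxA.
have -> : J x *m g b (F x) *m (C r *m J x)^T = g a x *m (C r)^T.
  by rewrite (metric_transform g Vx) trmx_mul !mulmxA.
rewrite mx_addE !mx_mulE -big_split; apply: eq_bigr => m _ /=.
by rewrite mx_trE [g a x p m * _]mulrC.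
Qed.

(** Curvature commutes with pullback: derivatives of J enter only through the sum of d_i J_jk B_k,
    which is symmetric in i, j and cancels. *)
Lemma curv_pull i j x : V x ->
  dmx i (pull j) x - dmx j (pull i) x + pull j x *m pull i x - pull i x *m pull j x =
  \sum_k \sum_l (J x i k * J x j l) *: curv B k l (F x).
Proof.
move=> Vx.
have dF := transition_differentiable Vx.
have dB k := smooth_diff_mx (smooth_metric_conn (a := b) g k) (transition_img Vx).
have dP p q : dmx p (pull q) x = \sum_k dmx p J x q k *: B k (F x) +
    \sum_k \sum_l (J x p k * J x q l) *: dmx k (B l) (F x).
  rewrite dmx_sum => [|k]; last first.
    apply: diff_mxZ; first exact: smooth_differentiable (smooth_jacobian q k) Vx.
    exact: diff_mx_comp dF (dB k).
  rewrite exchange_big -big_split; apply: eq_bigr => l _ /=.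
  rewrite (dmxZ p (smooth_differentiable (smooth_jacobian q l) Vx) (diff_mx_comp dF (dB l))).
  rewrite (dmx_comp p dF (dB l)) dmxE scaler_sumr; congr (_ + _).
  by apply: eq_bigr => k _; rewrite scalerA mulrC.
have PP p q : pull p x *m pull q x = \sum_k \sum_l (J x p k * J x q l) *: (B k (F x) *m B l (F x)).
  rewrite /pull mulmx_suml; apply: eq_bigr => k _; rewrite mulmx_sumr.
  by apply: eq_bigr => l _; rewrite -scalemxAl -scalemxAr scalerA.
have swap (C : 'I_n -> 'I_n -> 'M[R]_n) : \sum_k \sum_l (J x j k * J x i l) *: C k l =
    \sum_k \sum_l (J x i k * J x j l) *: C l k.
  rewrite exchange_big; apply: eq_bigr => l _; apply: eq_bigr => k _.
  by rewrite mulrC.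
rewrite !dP !PP !swap.
have -> : \sum_k dmx j J x i k *: B k (F x) = \sum_k dmx i J x j k *: B k (F x).
  by apply: eq_bigr => k _; congr (_ *: _); exact: dmx_jacobianC.
rewrite scaler_sum_commutator; apply: eq_bigr => k _; apply: eq_bigr => l _.
by rewrite curv_def.
Qed.

Lemma curv_transition i j x : V x -> curv A i j x *m J x =
  J x *m \sum_k \sum_l (J x i k * J x j l) *: curv B k l (F x).
Proof.
move=> Vx; rewrite -curv_pull //.
have dJ := smooth_diff_mx smooth_jacobian Vx.
have dA k := smooth_diff_mx (smooth_metric_conn (a := a) g k) (overlap_img Vx).
have ddJ k := smooth_diff_mx (smooth_dmx overlap_open k smooth_jacobian) Vx.
have E p q : dmx p (A q) x *m J x + A q x *m dmx p J x =
    dmx p (dmx q J) x + (dmx p J x *m pull q x + J x *m dmx p (pull q) x).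
  rewrite -(dmxM p (dA q) dJ) -(dmxM p dJ (pull_diff_mx q Vx)).
  rewrite -(dmxD p (ddJ q) (diff_mxM dJ (pull_diff_mx q Vx))).
  by apply: (eq_dmx p overlap_open Vx) => y Vy; exact: conn_transition.
apply: (gauge_curvature_algebra (conn_transition i Vx) (conn_transition j Vx) (E i j)).
by rewrite (dmx_comm i j overlap_open smooth_jacobian Vx) E.
Qed.

(** In the trace over l, the factor J_lk coming from a form index meets J^-1 and cancels it, leaving
    one J for each index of Ric. *)
Lemma ricci_transition x : V x ->
  ricci (g a) x = J x *m ricci (g b) (F x) *m (J x)^T.
Proof.
move=> Vx; have Ju := jacobian_unit Vx.
have curvA l j : curv A l j x =
    \sum_k \sum_m (J x l k * J x j m) *: (J x *m curv B k m (F x) *m invmx (J x)).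
  rewrite -[LHS](mulmxK Ju) curv_transition // mulmx_sumr mulmx_suml.
  apply: eq_bigr => k _; rewrite mulmx_sumr mulmx_suml.
  by apply: eq_bigr => m _; rewrite -scalemxAr -scalemxAl.
apply/matrixP => i j; rewrite ricciE.
have -> : \sum_l curv A l j x i l = \sum_m J x j m * \sum_k
    (J x *m curv B k m (F x) *m invmx (J x) *m J x) i k.
  under eq_bigr do rewrite curvA summxE.
  rewrite exchange_big /=.
  under eq_bigr => k _ do under eq_bigr => l _ do rewrite summxE.
  under eq_bigr => k _ do rewrite exchange_big /=.
  rewrite exchange_big /=; apply: eq_bigr => m _.
  rewrite mulr_sumr; apply: eq_bigr => k _.
  rewrite [in RHS]mx_mulE mulr_sumr; apply: eq_bigr => l _.
  by rewrite mx_scaleE; ring.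
rewrite mx_mulE; apply: eq_bigr => m _; rewrite mx_trE mulrC; congr (_ * _).
rewrite mx_mulE.
under [RHS]eq_bigr do rewrite ricciE mulr_sumr.
rewrite [RHS]exchange_big; apply: eq_bigr => k _ /=.
by rewrite mulmxKV // mx_mulE.
Qed.

End Transition.

(** * Recurrent Ricci tensors *)

Lemma near_bounded (R : realType) (T : topologicalType) (I : finType) (F : I -> T -> R) x :
  (forall k, {for x, continuous (F k)}) ->
  exists2 K, 0 <= K & \forall y \near x, forall k, `|F k y| <= K.
Proof.
move=> cF; exists (\sum_k (`|F k x| + 1)).
  by apply: sumr_ge0 => k _; rewrite addr_ge0.
apply: filter_forall => k.
have /cvgrPdist_lt/(_ _ ltr01) := cF k.
apply: filterS => y Fy.
apply: (@le_trans _ _ (`|F k x| + 1)).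
  rewrite -[F k y](subrK (F k x)) addrC; apply: le_trans (ler_normD _ _) _.
  by rewrite lerD2l distrC ltW.
by rewrite (bigD1 k) //= lerDl sumr_ge0 // => m _; rewrite addr_ge0.
Qed.

(** * Zeros of solutions of linear first-order systems *)

Section LinearSystem.
Variables (R : realType) (n : nat) (U : set 'rV[R]_n).
Variables (T : 'rV[R]_n -> 'M[R]_n) (A : 'I_n -> 'rV[R]_n -> 'M[R]_n).
Variable b : 'I_n -> 'rV[R]_n -> R.
Hypotheses (oU : open U) (sT : smooth_mx U T) (sA : forall l, smooth_mx U (A l)).
Hypothesis sb : forall l, smooth_on U (b l).
Hypothesis dT : forall l y, U y ->
  dmx l T y = A l y *m T y + T y *m (A l y)^T + b l y *: T y.

Let sumT y := \sum_(k : 'I_n * 'I_n) `|T y k.1 k.2|.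

Let sumT_row y i : \sum_m `|T y i m| <= sumT y.
Proof.
rewrite /sumT -(pair_bigA _ (fun i j => `|T y i j|)) /= [leRHS](bigD1 i) //= lerDl.
by apply: sumr_ge0 => k _; apply: sumr_ge0.
Qed.

Let sumT_col y j : \sum_m `|T y m j| <= sumT y.
Proof.
rewrite /sumT -(pair_bigA _ (fun i j => `|T y i j|)) /=.
by apply: ler_sum => i _; rewrite (bigD1 j) //= lerDl sumr_ge0.
Qed.

Let sumT_entry y i j : `|T y i j| <= sumT y.
Proof. by rewrite /sumT (bigD1 (i, j)) //= lerDl sumr_ge0. Qed.

(** The factor 3 counts the summands A T, T A^T and b T, each bounded by [K * sumT y]. *)
Let dT_bound l y i j K : U y -> 0 <= K -> (forall l i j, `|A l y i j| <= K) ->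
  (forall l, `|b l y| <= K) -> `|dmx l T y i j| <= 3 * K * sumT y.
Proof.
move=> Uy K0 AK bK; rewrite dT // 2!mx_addE mx_scaleE !mx_mulE.
have -> : 3 * K * sumT y = K * sumT y + K * sumT y + K * sumT y by ring.
apply: le_trans (ler_normD _ _) _; apply: lerD.
  apply: le_trans (ler_normD _ _) _; apply: lerD.
    apply: le_trans (ler_norm_sum _ _ _) _.
    apply: le_trans _ (ler_wpM2l K0 (sumT_col y j)); rewrite mulr_sumr.
    by apply: ler_sum => m _; rewrite normrM ler_wpM2r.
  apply: le_trans (ler_norm_sum _ _ _) _.
  apply: le_trans _ (ler_wpM2l K0 (sumT_row y i)); rewrite mulr_sumr.
  by apply: ler_sum => m _; rewrite normrM mx_trE mulrC ler_wpM2r.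
by rewrite normrM ler_pM // sumT_entry.
Qed.

(* Along every ray from x, T solves a linear ODE with bounded coefficients. *)
Lemma linear_system_near_zero x : U x -> T x = 0 -> \forall y \near x, T y = 0.
Proof.
move=> Ux Tx.
have cA (k : 'I_n * 'I_n * 'I_n) : {for x, continuous (fun y => A k.1.1 y k.1.2 k.2)}.
  by apply: differentiable_continuous; exact: smooth_differentiable (sA _ _ _) Ux.
have cb l : {for x, continuous (b l)}.
  by apply: differentiable_continuous; exact: smooth_differentiable (sb l) Ux.
have [K1 K10 nA] := near_bounded cA; have [K2 K20 nb] := near_bounded cb.
pose K := K1 + K2; have K0 : 0 <= K by exact: addr_ge0.
have nU : nbhs x U by exact: open_nbhs_nbhs.
have : \forall y \near x, U y /\ (forall k : 'I_n * 'I_n * 'I_n, `|A k.1.1 y k.1.2 k.2| <= K1) /\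
    (forall l, `|b l y| <= K2) by exact: filterI nU (filterI nA nb).
move=> /nbhs_ballP[d /= d0 Bd].
apply: filterS (nbhsx_ballx x d d0) => y By.
(* The segment from x reaches y at parameter 1 and stays in the ball, where one constant bounds all
   coefficients. *)
pose v := y - x.
have Bt (t : R) : 0 <= t <= 1 -> ball x d (x + t *: v).
  move=> /andP[t0 t1]; move: By; rewrite -ball_normE /= => By.
  rewrite opprD addNKr normrN normrZ (ger0_norm t0); apply: le_lt_trans _ By.
  by rewrite /v distrC ler_piMl.
pose h (k : 'I_n * 'I_n) (t : R) := T (x + t *: v) k.1 k.2.
pose h' (k : 'I_n * 'I_n) (t : R) := \sum_l v 0 l * dmx l T (x + t *: v) k.1 k.2.
have dh k (t : R) : 0 <= t <= 1 -> is_derive t 1 (h k) (h' k t).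
  move=> /Bt/Bd[Uy _].
  have dTk := smooth_differentiable (sT k.1 k.2) Uy.
  have := is_derive_line dTk; rewrite derive_partial //.
  by under eq_bigr do rewrite -dmxE.
have hb k (t : R) : 0 <= t <= 1 ->
    `|h' k t| <= (\sum_l `|v 0 l|) * (3 * K) * \sum_m `|h m t|.
  move=> /Bt/Bd[Uy [Ay by_]]; rewrite -mulrA mulr_suml.
  apply: le_trans (ler_norm_sum _ _ _) _; apply: ler_sum => l _.
  rewrite normrM; apply: ler_wpM2l => //; apply: dT_bound => //.
  - by move=> l' i j; apply: le_trans (Ay (l', i, j)) _; rewrite lerDl.
  - by move=> l'; apply: le_trans (by_ l') _; rewrite lerDr.
have C0 : 0 <= (\sum_l `|v 0 l|) * (3 * K).
  by rewrite mulr_ge0 ?sumr_ge0 // mulr_ge0.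
have h0 k : h k 0 = 0 by rewrite /h scale0r addr0 Tx mxE.
apply/matrixP => i j; have := gronwall_zero C0 dh hb h0 (i, j).
by rewrite /h /= scale1r /v addrC subrK mxE.
Qed.

End LinearSystem.

(** * From charts to the whole manifold *)

Section Global.
Variables (R : realType) (n : nat) (M : manifold R n) (g : metric M).
Implicit Types (p q : M) (a c : chart_index M).

Lemma near_chart a p (P : set 'rV[R]_n) : chart_dom (atlas a) p ->
  (\forall y \near atlas a p, P y) ->
  \forall q \near p, chart_dom (atlas a) q /\ P (atlas a q).
Proof.
move=> ap nP; apply: filterI; last exact: (chart_map_cont ap).
by apply: open_nbhs_nbhs; split => //; exact: chart_dom_open.
Qed.

Lemma transition_chart a c p : chart_dom (atlas a) p -> chart_dom (atlas c) p ->
  overlap (atlas a) (atlas c) (atlas a p) /\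
  transition (atlas a) (atlas c) (atlas a p) = atlas c p.
Proof. by move=> ap cp; split; [exists p|rewrite /transition /= chart_mapK]. Qed.

Lemma chart_imgP a p : chart_dom (atlas a) p -> chart_img (atlas a) (atlas a p).
Proof. by move=> ap; exists p. Qed.

(** Carries alpha from the chart witnessing that it is nonzero to the chart in which Ric is known to
    be nonzero. *)
Lemma nonzero_form_chart (w : one_form M) a c p :
  chart_dom (atlas a) p -> chart_dom (atlas c) p ->
  w a (atlas a p) != 0 -> w c (atlas c p) != 0.
Proof.
move=> ap cp; have [ov <-] := transition_chart ap cp.
by apply: contra_neq => w0; rewrite (form_transform w ov) w0 mul0mx.
Qed.

(** [recurrent] demands a nonzero form and thus excludes the parallel case; plain coefficient
    functions cover both beta and 0. *)
Variable b : chart_index M -> 'I_n -> 'rV[R]_n -> R.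
Hypothesis sb : forall a l, smooth_on (chart_img (atlas a)) (b a l).
Hypothesis rec : forall a x, chart_img (atlas a) x -> forall i j l,
  nabla g (ricci_tensor g) a x i j l = b a l x * ricci_tensor g a x i j.

Let Ric := ricci_tensor g.

Lemma dmx_ricci_recurrent a l x : chart_img (atlas a) x ->
  dmx l (Ric a) x = conn (g a) l x *m Ric a x + Ric a x *m (conn (g a) l x)^T
    + b a l x *: Ric a x.
Proof.
move=> ax; rewrite [RHS]addrC; apply/eqP; rewrite -subr_eq; apply/eqP/matrixP => i j.
by rewrite -cov_derivE mx_scaleE; exact: rec.
Qed.

Lemma open_nonzero_ricci : open [set p | nonzero_at Ric p].
Proof.
rewrite openE => p [a ap Rp].
have /matrix0Pn[i [j Rij]] := Rp.
have cR : {for atlas a p, continuous (fun y => Ric a y i j)}.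
  apply: differentiable_continuous.
  exact: smooth_differentiable (smooth_metric_ricci (a := a) g i j) (chart_imgP ap).
have nR : \forall y \near atlas a p, Ric a y i j != 0.
  have r0 : 0 < `|Ric a (atlas a p) i j| by rewrite normr_gt0.
  have /cvgrPdist_lt/(_ _ r0) := cR; apply: filterS => y; apply: contraTneq => ->.
  by rewrite subr0 ltxx.
apply: filterS (near_chart ap nR) => q [aq Rq]; exists a; first exact: aq.
by apply: contra_neq Rq => ->; rewrite mxE.
Qed.

(** A zero in chart a spreads to a neighbourhood by [linear_system_near_zero]; a nonzero value there
    in another chart c would contradict [ricci_transition]. *)
Lemma closed_nonzero_ricci : closed [set p | nonzero_at Ric p].
Proof.
rewrite -openC openE => p Np /=.
have [a ap] := atlas_cover p.
have R0 : Ric a (atlas a p) = 0.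
  by apply/eqP/negPn/negP => Rp; apply: Np; exists a.
have nR := linear_system_near_zero (@chart_img_open _ _ _ (atlas a)) (smooth_metric_ricci (a := a) g)
  (smooth_metric_conn (a := a) g) (@sb a) (@dmx_ricci_recurrent a) (chart_imgP ap) R0.
apply: filterS (near_chart ap nR) => q [aq Rq] [c cq].
have [ov e] := transition_chart cq aq.
by rewrite /Ric /ricci_tensor (ricci_transition g ov) e Rq mulmx0 mul0mx eqxx.
Qed.

(** The nonzero locus is open and closed, and [nonzero_tensor] makes it meet the component of every
    point. *)
Lemma nonzero_ricci_everywhere p : nonzero_tensor Ric -> nonzero_at Ric p.
Proof.
move=> /(_ p)[q pq Nq]; pose N := [set r | nonzero_at Ric r].
pose C := connected_component [set: M] p.
have CN : C `&` N = C.
  apply: (component_connected (A := [set: M]) (x := p)); first by exists q.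
    by exists N; first exact: open_nonzero_ricci.
  by exists N; first exact: closed_nonzero_ricci.
have : C p by exact: connected_component_refl.
by rewrite -CN => -[].
Qed.

Lemma recurrent_not_pseudo_symmetric :
  nonzero_tensor Ric -> ~ pseudo_symmetric g Ric.
Proof.
move=> R0 [alpha [p [a ap alpha0]] psym].
have [c cp] := nonzero_ricci_everywhere p R0.
move: (chart_imgP cp) (nonzero_form_chart ap cp alpha0).
move: (atlas c p : 'rV[R]_n) => x cx alphac /eqP; apply.
apply: (recurrent_pseudo_symmetric_eq0 (g := g c x) (alpha := alpha c x)
  (beta := \row_l b c l x) (Om := fun i j => curv (conn (g c)) i j x)
  (om := fun i j => partial i (b c j) x - partial j (b c i) x)).
- exact: (Defs.metric_sym g cx).
- exact: (metric_pos g cx).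
- by move=> i j; exact: curv_metric.
- by move=> i j; exact: ricciE.
- exact: ricci_sym.
- move=> i j; exact: (ricci_identity (@chart_img_open _ _ _ (atlas c)) (smooth_metric_conn (a := c) g)
    (smooth_metric_ricci (a := c) g) (@sb c) (@dmx_ricci_recurrent c) i j cx).
- by move=> i j l; rewrite mxE -rec // psym.
- exact: alphac.
Qed.

End Global.

Theorem corollary3p2 (R : realType) (n : nat) (M : manifold R n)
    (g : metric M) :
  (3 <= n)%N -> nonzero_tensor (ricci_tensor g) ->
  ~ (recurrent g (ricci_tensor g) /\ pseudo_symmetric g (ricci_tensor g)) /\
  (parallel g (ricci_tensor g) -> ~ pseudo_symmetric g (ricci_tensor g)).
Proof.
move=> _ R0; split=> [[[beta _ brec]]|par].
  apply: (@recurrent_not_pseudo_symmetric _ _ _ g (fun a l x => beta a x 0 l)) => //.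
  by move=> a l; exact: form_smooth.
apply: (@recurrent_not_pseudo_symmetric _ _ _ g (fun _ _ _ => 0)) => //.
  by move=> a l; apply: smooth_cst; exact: chart_img_open.
by move=> a x ax i j l; rewrite mul0r; exact: par.
Qed.
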